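(* No $\mathbb{Z}_2$-lattice of rank $6$ is primitively $3$-universal. Therefore, $u^\ast_{\mathbb{Z}_2}(3) = 7$.
   Context: A $\mathbb{Z}_2$-lattice is a finitely generated $\mathbb{Z}_2$-submodule of a quadratic space $(V,B)$ over $\mathbb{Q}_2$, assumed integral ($B(L,L)\subseteq\mathbb{Z}_2$) and nondegenerate. A representation is a $\mathbb{Z}_2$-linear map preserving $B$; it is primitive if its image is a direct summand. A lattice is primitively $n$-universal if it primitively represents every $\mathbb{Z}_2$-lattice of rank $n$; $u^\ast_{\mathbb{Z}_2}(n)$ is the minimal rank of such a lattice. *)

(* Defs.v *)
From HB Require Import structures.
From mathcomp Require Import all_boot all_order all_algebra.
From mathcomp Require Import boolp.
Set Implicit Arguments.
Unset Strict Implicit.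
Unset Printing Implicit Defensive.
Import Order.TTheory GRing.Theory Num.Theory.
Local Open Scope ring_scope.

(* The ring Z_2 of 2-adic integers, as the inverse limit of Z/2^k Z:        *)
(* an element is a sequence (x_k)_k of integers with x_k in [0, 2^k) and    *)
(* x_k = x_{k+1} mod 2^k.                                                    *)

Definition pw (k : nat) : int := 2 ^+ k.

Record Z2 := MkZ2 {
  z2s : nat -> int ;
  z2P : forall k, z2s k = modz (z2s k.+1) (pw k) }.

HB.instance Definition _ := gen_eqMixin Z2.
HB.instance Definition _ := gen_choiceMixin Z2.

Lemma pw_neq0 k : pw k != 0.
Proof. by rewrite /pw expf_neq0. Qed.

Lemma modz_pwS (x : int) k : modz (modz x (pw k.+1)) (pw k) = modz x (pw k).
Proof.
rewrite {2}(divz_eq x (pw k.+1)) /pw exprSr mulrA -[_ * _ * 2]mulrAC.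
by rewrite modzMDl.
Qed.

Lemma z2_red (x : Z2) k : modz (z2s x k) (pw k) = z2s x k.
Proof. by rewrite z2P modz_mod. Qed.

Lemma z2_eq (x y : Z2) : (forall k, z2s x k = z2s y k) -> x = y.
Proof.
case: x y => [f Pf] [g Pg] /= H.
have E : f = g by apply: funext.
subst g; congr MkZ2; exact: Prop_irrelevance.
Qed.

Definition z2mk (f : nat -> int)
  (H : forall k, (f k.+1 = f k %[mod pw k])%Z) : Z2.
Proof.
refine (@MkZ2 (fun k => modz (f k) (pw k)) _) => k.
by rewrite modz_pwS H.
Defined.

Definition z2zero : Z2 := @z2mk (fun _ => 0) (fun _ => erefl).
Definition z2one : Z2 := @z2mk (fun _ => 1) (fun _ => erefl).

Definition z2add (x y : Z2) : Z2.
Proof.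
refine (@z2mk (fun k => z2s x k + z2s y k) _) => k.
by rewrite [z2s x k](z2P x k) [z2s y k](z2P y k) modzDm.
Defined.

Definition z2opp (x : Z2) : Z2.
Proof.
refine (@z2mk (fun k => - z2s x k) _) => k.
by rewrite [z2s x k](z2P x k) modzNm.
Defined.

Definition z2mul (x y : Z2) : Z2.
Proof.
refine (@z2mk (fun k => z2s x k * z2s y k) _) => k.
by rewrite [z2s x k](z2P x k) [z2s y k](z2P y k) modzMm.
Defined.

Lemma z2addA : associative z2add.
Proof. by move=> x y z; apply: z2_eq => k /=; rewrite modzDml modzDmr addrA. Qed.
Lemma z2addC : commutative z2add.
Proof. by move=> x y; apply: z2_eq => k /=; rewrite addrC. Qed.
Lemma z2add0 : left_id z2zero z2add.
Proof. by move=> x; apply: z2_eq => k /=; rewrite modzDml add0r z2_red. Qed.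
Lemma z2addN : left_inverse z2zero z2opp z2add.
Proof. by move=> x; apply: z2_eq => k /=; rewrite modzDml addNr. Qed.

HB.instance Definition _ := GRing.isZmodule.Build Z2 z2addA z2addC z2add0 z2addN.

Lemma z2mulA : associative z2mul.
Proof. by move=> x y z; apply: z2_eq => k /=; rewrite modzMml modzMmr mulrA. Qed.
Lemma z2mulC : commutative z2mul.
Proof. by move=> x y; apply: z2_eq => k /=; rewrite mulrC. Qed.
Lemma z2mul1 : left_id z2one z2mul.
Proof. by move=> x; apply: z2_eq => k /=; rewrite modzMml mul1r z2_red. Qed.
Lemma z2mulDl : left_distributive z2mul (@GRing.add Z2).
Proof.
by move=> x y z; apply: z2_eq => k /=; rewrite modzMml modzDm mulrDl.
Qed.
Lemma z2one_neq0 : z2one != 0 :> Z2.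
Proof.
apply/eqP => H; have := congr1 (fun a => z2s a 1) H.
by rewrite /= /pw expr1 modz_small.
Qed.

HB.instance Definition _ :=
  GRing.Zmodule_isComNzRing.Build Z2 z2mulA z2mulC z2mul1 z2mulDl z2one_neq0.

(* Z_2-lattices.  A Z_2-lattice of rank n is a free Z_2-module of rank n     *)
(* with an integral symmetric bilinear form; it is given by its Gram matrix  *)
(* G : 'M[Z2]_n with respect to a basis (vectors = coordinate columns).      *)

Definition is_lattice (n : nat) (G : 'M[Z2]_n) : Prop :=
  G^T = G /\ (forall v : 'cV[Z2]_n, G *m v = 0 -> v = 0).

Definition is_submodule (n : nat) (S : 'cV[Z2]_n -> Prop) : Prop :=
  S 0 /\ (forall u v, S u -> S v -> S (u + v)) /\
  (forall (a : Z2) v, S v -> S (a *: v)).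

Definition is_direct_summand (n : nat) (S : 'cV[Z2]_n -> Prop) : Prop :=
  exists T : 'cV[Z2]_n -> Prop, is_submodule T /\
    (forall v, exists s t, S s /\ T t /\ v = s + t) /\
    (forall v, S v -> T v -> v = 0).

Definition image_of (n m : nat) (X : 'M[Z2]_(n, m)) : 'cV[Z2]_n -> Prop :=
  fun v => exists w : 'cV[Z2]_m, v = X *m w.

(* X (columns = images of the basis of K) is a representation of the
   lattice with Gram matrix A by the lattice with Gram matrix G *)
Definition is_representation (n m : nat) (G : 'M[Z2]_n) (A : 'M[Z2]_m)
  (X : 'M[Z2]_(n, m)) : Prop := X^T *m G *m X = A.

Definition is_primitive_representation (n m : nat) (G : 'M[Z2]_n)
  (A : 'M[Z2]_m) (X : 'M[Z2]_(n, m)) : Prop :=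
  is_representation G A X /\ is_direct_summand (image_of X).

Definition prim_universal (k n : nat) (G : 'M[Z2]_n) : Prop :=
  forall A : 'M[Z2]_k, is_lattice A ->
    exists X : 'M[Z2]_(n, k), is_primitive_representation G A X.

Definition u_star_Z2_is (k r : nat) : Prop :=
  (exists G : 'M[Z2]_r, is_lattice G /\ prim_universal k G) /\
  (forall r', (r' < r)%N ->
     forall G : 'M[Z2]_r', is_lattice G -> ~ prim_universal k G).

(* Main.v *)
Require Import Defs.
From HB Require Import structures.
From mathcomp Require Import all_boot all_order all_algebra.
From mathcomp Require Import perm boolp zify ring.

Set Implicit Arguments.
Unset Strict Implicit.
Unset Printing Implicit Defensive.
Import Order.TTheory GRing.Theory Num.Theory.
Local Open Scope ring_scope.

(** A rank 7 lattice that works is H + H + H + <1>: embed by (1; Y; t), where t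
    has the parities of the diagonal of A and A - t^T t = Y + Y^T.

    Conversely let L have rank 6 (smaller ranks embed in rank 6), and suppose that
    it primitively represents all the lattices T(a, c) = a A2 + <c>, where A2 is
    the plane [2 1; 1 2]. Letting a and c tend to 0, compactness gives a primitive
    totally isotropic sublattice of rank 3, so L has Gram matrix [0 D; D^T C],
    where D = diag(2^b0, 2^b, 2^b q) after a change of bases.
    If b0 > 0, then T(1, 1) and T(1, 3) cannot both be represented, as they would
    both be congruent mod 4 to C. So b0 = 0, and C may be taken to be
    <e> + [c1 c2; c2 c3].
    If b > 0, the representations of T(1, 1), T(1, 2), T(1, 3) mod 4 force
    c1 c3 - c2^2 = 2 mod 4, and then a primitive representation of 4 T by L gives
    one of T by the lattice where b is replaced by b - 1 (T even).
    If b = 0 and c3 is odd, L is H + H + [0 q; q c3], and by Witt cancellation of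
    A2 a representation of T(1, 4 q^2) makes 4 q^2 primitively represented by
    -A2 + [0 q; q c3], which an infinite descent refutes. The remaining cases
    reduce to this one by symmetry or are excluded by T(1, 1), T(1, 2), T(2, 8). *)

(** * Arithmetic of the 2-adic integers *)

Lemma pw_gt0 k : 0 < pw k.
Proof. by rewrite /pw exprn_gt0. Qed.

Lemma pwS k : pw k.+1 = 2 * pw k.
Proof. by rewrite /pw exprS. Qed.

Lemma z2s_mod (x : Z2) j k : (j <= k)%N -> z2s x j = (z2s x k %% pw j)%Z.
Proof.
elim: k => [|k IH]; first by rewrite leqn0 => /eqP ->; rewrite z2_red.
rewrite leq_eqVlt => /orP [/eqP ->|]; first by rewrite z2_red.
rewrite ltnS => jk; rewrite IH // (z2P x k).
have -> : pw k = pw (k - j) * pw j by rewrite /pw -exprD subnK.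
set a := z2s x k.+1; rewrite {2}(divz_eq a (pw (k - j) * pw j)).
by rewrite mulrA modzMDl.
Qed.

Lemma z2s_ge0 (x : Z2) k : 0 <= z2s x k.
Proof. by rewrite -z2_red modz_ge0 // pw_neq0. Qed.

Lemma z2s_lt (x : Z2) k : z2s x k < pw k.
Proof. by rewrite -z2_red ltz_pmod // pw_gt0. Qed.

Lemma z2s_nat n k : z2s n%:R k = (n%:Z %% pw k)%Z.
Proof.
elim: n => [|n IH]; first by [].
by rewrite mulrS /= IH modzDm -intS.
Qed.

Lemma z2s0 k : z2s 0 k = 0.
Proof. by rewrite (z2s_nat 0) mod0z. Qed.

Lemma z2s_dbl (x : Z2) k : z2s (2 * x) k.+1 = 2 * z2s x k.
Proof.
have -> : (2 : Z2) * x = x + x by ring.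
rewrite /= pwS (z2s_mod x (leqnSn k)).
set a := z2s x k.+1; rewrite {1 2}(divz_eq a (pw k)).
set q := (a %/ _)%Z; set r := (a %% _)%Z.
have -> : q * pw k + r + (q * pw k + r) = q * (2 * pw k) + 2 * r by ring.
rewrite modzMDl modz_small // mulr_ge0 ?modz_ge0 ?pw_neq0 //=.
by rewrite ltr_pM2l // ltz_pmod // pw_gt0.
Qed.

(** This coherence makes the halved residues an element of Z_2. Halving costs one binary digit, so
    entry k of the half is read off entry k + 1 of x. *)
Lemma z2s_half (x : Z2) k :
  ((z2s x k.+2 %/ 2)%Z = (z2s x k.+1 %/ 2)%Z %[mod pw k])%Z.
Proof.
rewrite (z2P x k.+1) pwS; set a := z2s x k.+2.
have -> : (a %% (2 * pw k))%Z = (- (a %/ (2 * pw k))%Z * pw k) * 2 + a.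
  by rewrite /modz; ring.
by rewrite divzMDl // modzMDl.
Qed.

Lemma even_half (x : Z2) : z2s x 1 = 0 -> exists y, x = 2 * y.
Proof.
move=> x0; exists (z2mk (z2s_half x)); apply: z2_eq => -[|k].
  by rewrite (z2s_mod _ (leq0n 1)) x0 -[RHS]z2_red /= !modz1.
rewrite z2s_dbl /=.
have e0 : (z2s x k.+1 %% 2)%Z = 0 by rewrite -x0 (z2s_mod x (ltn0Sn k)).
have h : z2s x k.+1 = 2 * (z2s x k.+1 %/ 2)%Z.
  by rewrite {1}(divz_eq (z2s x k.+1) 2) e0 addr0 mulrC.
have [l g] := (z2s_lt x k.+1, z2s_ge0 x k.+1).
rewrite modz_small //; move: l g; rewrite pwS; lia.
Qed.

Lemma z2s_eq0P (x : Z2) k : reflect (exists t, x = 2 ^+ k * t) (z2s x k == 0).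
Proof.
apply: (iffP eqP) => [|[t ->]]; last first.
  elim: k => [|k IH]; last by rewrite exprS -mulrA z2s_dbl IH.
  by rewrite -[LHS]z2_red modz1.
elim: k x => [|k IH] x x0; first by exists x; rewrite mul1r.
have [|y xy] := @even_half x; first by rewrite (z2s_mod x (ltn0Sn k)) x0 mod0z.
have [|t yt] := IH y; last by exists t; rewrite xy yt exprS mulrA.
move: x0; rewrite xy z2s_dbl => /eqP; by rewrite mulf_eq0 => /orP[//|/eqP].
Qed.

Lemma z2_sep (x : Z2) : (forall k, exists t, x = 2 ^+ k * t) -> x = 0.
Proof.
by move=> h; apply: z2_eq => k; rewrite z2s0; apply/eqP/z2s_eq0P/h.
Qed.

Lemma z2_limit (u : nat -> Z2) :
    (forall k, exists t, u k.+1 = u k + 2 ^+ k * t) ->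
  exists l, forall k, z2s l k = z2s (u k) k.
Proof.
move=> hu; have H k : (z2s (u k.+1) k.+1 = z2s (u k) k %[mod pw k])%Z.
  have [t ut] := hu k; rewrite -z2P z2_red ut.
  have /eqP t0 : z2s (2 ^+ k * t) k == 0 by apply/z2s_eq0P; exists t.
  by rewrite [LHS](_ : _ = modz (z2s (u k) k + z2s (2 ^+ k * t) k) (pw k)) // t0 addr0 z2_red.
by exists (z2mk H) => k /=; rewrite z2_red.
Qed.

(** * Reduction modulo 2, units and valuations *)

Definition red (x : Z2) : 'F_2 := (z2s x 1)%:~R.

Lemma modz2F (m : int) : ((m %% 2)%Z)%:~R = m%:~R :> 'F_2.
Proof.
rewrite [in RHS](divz_eq m 2); move: (_ %% 2)%Z (_ %/ 2)%Z => r q; rewrite intrD intrM.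
have -> : (2%:~R : 'F_2) = 0 by apply/eqP; vm_compute.
by rewrite mulr0 add0r.
Qed.

Lemma red_is_zmod : zmod_morphism red.
Proof. by move=> x y; rewrite /red /= /pw expr1 modzDmr modz2F intrB. Qed.

Lemma red_is_monoid : monoid_morphism red.
Proof.
split; first by rewrite /red /= /pw expr1 modz2F.
by move=> x y; rewrite /red /= /pw expr1 modz2F intrM.
Qed.

HB.instance Definition _ := GRing.isZmodMorphism.Build Z2 'F_2 red red_is_zmod.
HB.instance Definition _ := GRing.isMonoidMorphism.Build Z2 'F_2 red red_is_monoid.

Definition par (x : Z2) : bool := red x != 0.

Lemma F2P (a : 'F_2) : a = (a != 0)%:R.
Proof. by case: a => -[|[|//]] ?; apply: val_inj. Qed.

Lemma redE x : red x = (par x)%:R.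
Proof. exact: F2P. Qed.

Lemma parE x (b : bool) : red x = b%:R -> par x = b.
Proof. by rewrite /par => ->; case: b. Qed.

Lemma parD x y : par (x + y) = par x (+) par y.
Proof. by apply: parE; rewrite rmorphD /= !redE; case: (par x); case: (par y); exact: val_inj. Qed.
Lemma parM x y : par (x * y) = par x && par y.
Proof. by apply: parE; rewrite rmorphM /= !redE; case: (par x); case: (par y); exact: val_inj. Qed.
Lemma parN x : par (- x) = par x.
Proof. by apply: parE; rewrite rmorphN /= !redE; case: (par x); exact: val_inj. Qed.
Lemma par0 : par 0 = false.
Proof. by apply: parE; rewrite rmorph0. Qed.
Lemma par1 : par 1 = true.
Proof. by apply: parE; rewrite rmorph1. Qed.
Lemma par_nat n : par n%:R = odd n.
Proof. by elim: n => [|n IH]; rewrite ?par0 // mulrS parD par1 IH. Qed.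

Definition parS := (parD, parM, parN, par_nat, par0, par1).

Lemma par_half x : par x = false -> exists y, x = 2 * y.
Proof.
move=> p0; apply: even_half; move: p0; rewrite /par /red.
have := z2s_lt x 1; have := z2s_ge0 x 1; rewrite /pw expr1.
by case: (z2s x 1) => // -[|[|n]].
Qed.

Lemma par_dbl x : par (2 * x) = false.
Proof. by rewrite parS. Qed.

Lemma par_exists (x : Z2) : exists y, x = (par x)%:R + 2 * y.
Proof.
have [|y hy] := @par_half (x - (par x)%:R).
  by rewrite !parS; case: (par x).
by exists y; rewrite -hy addrC subrK.
Qed.

Lemma dbl_inj (x : Z2) : 2 * x = 0 -> x = 0.
Proof.
move=> x0; apply: z2_eq => k; rewrite z2s0; apply/eqP.
by have := z2s_dbl x k; rewrite x0 z2s0 => /esym/eqP; rewrite mulf_eq0.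
Qed.

(** With x = 1 + 2t, the inverse is the geometric series in -2t; consecutive partial sums [u k]
    differ by (-2t)^k, so they converge. *)
Lemma par_inv_ex (x : Z2) : par x -> exists y, y * x = 1.
Proof.
move=> px; have [t xt] := par_exists x; rewrite px -[_%:R]/1 in xt.
pose u k := \sum_(i < k) (- (2 * t)) ^+ i.
have [|l hl] := @z2_limit u.
  move=> k; exists ((- t) ^+ k).
  by rewrite /u big_ord_recr /= -exprMn mulrN.
exists l; apply/eqP; rewrite -subr_eq0; apply/eqP/z2_sep => k.
have [s ls] : exists s, l - u k = 2 ^+ k * s.
  by apply/z2s_eq0P; rewrite /= hl modzDmr subrr mod0z.
exists (s * x - (- t) ^+ k).
have -> : l = u k + 2 ^+ k * s by rewrite -ls addrC subrK.
have ux : u k * x = 1 - 2 ^+ k * (- t) ^+ k.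
  have -> : x = - (- (2 * t) - 1) by rewrite xt; ring.
  by rewrite mulrN mulrC -subrX1 opprB -exprMn mulrN.
by rewrite mulrDl ux; ring.
Qed.

(** Non-units are left fixed, as the unit ring structure demands of its inverse. *)
Definition z2inv (x : Z2) : Z2 :=
  if pselect (exists y, y * x = 1) is left h then projT1 (cid h) else x.

Lemma z2mulVx : {in par, left_inverse 1 z2inv *%R}.
Proof.
move=> x px; rewrite /z2inv; case: pselect => [h|]; first by case: (cid h).
by case; apply: par_inv_ex.
Qed.

Lemma z2unitPl (x y : Z2) : y * x = 1 -> par x.
Proof. by move/(congr1 par); rewrite !parS => /andP[]. Qed.

Lemma z2inv_out : {in [predC par], z2inv =1 id}.
Proof.
move=> x px; rewrite /z2inv; case: pselect => // -[y h].
by case/negP: px; apply: z2unitPl h.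
Qed.

HB.instance Definition _ :=
  GRing.ComNzRing_hasMulInverse.Build Z2 z2mulVx z2unitPl z2inv_out.

Lemma z2_valuation (x : Z2) : x != 0 -> exists k u, x = 2 ^+ k * u /\ par u.
Proof.
move=> x0; have /existsNP [k hk] : ~ (forall k, exists t, x = 2 ^+ k * t).
  by move=> h; move/eqP: x0; apply; apply: z2_sep.
elim: k x x0 hk => [|k IH] x x0 hk; first by case: hk; exists x; rewrite mul1r.
case px: (par x); first by exists 0%N, x; rewrite mul1r.
have [y xy] := par_half px.
have [||j [u [yu pu]]] := IH y.
- by apply: contra x0 => /eqP y0; rewrite xy y0 mulr0.
- by case=> t yt; apply: hk; exists t; rewrite xy yt exprS mulrA.
by exists j.+1, u; rewrite xy yu exprS mulrA.
Qed.

Lemma dblX_inj k (x : Z2) : 2 ^+ k * x = 0 -> x = 0.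
Proof.
by elim: k x => [|k IH] x; rewrite ?mul1r // exprS -mulrA => /dbl_inj/IH.
Qed.

Lemma z2_integral : GRing.integral_domain_axiom Z2.
Proof.
move=> x y xy0; apply/norP => -[/z2_valuation [k [u [xu pu]]] /eqP]; apply.
apply: (@dblX_inj k); apply: (can_inj (mulKr (pu : u \is a GRing.unit))).
by rewrite mulr0 -xy0 xu; ring.
Qed.

HB.instance Definition _ := GRing.ComUnitRing_isIntegral.Build Z2 z2_integral.

Lemma z2_two_neq0 : (2 : Z2) != 0.
Proof.
by apply/eqP => h; have := @dbl_inj 1; rewrite mulr1 => /(_ h)/eqP; rewrite oner_eq0.
Qed.

(** * Primitive matrices *)

Definition evm m n (M : 'M[Z2]_(m, n)) : Prop := map_mx red M = 0.

(** Injectivity modulo 2, that is, independence of the columns over F_2. Direct summands are used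
    only through this property, by [summand_primitive]. *)
Definition primitive m n (X : 'M[Z2]_(m, n)) : Prop :=
  forall w : 'cV_n, evm (X *m w) -> evm w.

Lemma evmP m n (M : 'M[Z2]_(m, n)) :
  evm M <-> forall i j, par (M i j) = false.
Proof.
split=> [/matrixP h i j|h].
  by have := h i j; rewrite !mxE /par => ->; rewrite eqxx.
by apply/matrixP => i j; rewrite !mxE redE h.
Qed.

Definition lift2 (a : 'F_2) : Z2 := (a != 0)%:R.

Lemma lift2K : cancel lift2 red.
Proof. by move=> a; rewrite [RHS]F2P /lift2; case: (a != 0); rewrite ?rmorph0 ?rmorph1. Qed.

Lemma lift2_mxK m n (M : 'M['F_2]_(m, n)) : map_mx red (map_mx lift2 M) = M.
Proof. by apply/matrixP => i j; rewrite !mxE lift2K. Qed.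

Lemma unitmx_red n (M : 'M[Z2]_n) :
  (M \in unitmx) = (map_mx red M \in unitmx).
Proof. by rewrite !unitmxE det_map_mx unitfE. Qed.

(** Since Z_2 is local, invertibility is tested over F_2, where a nonzero kernel vector would lift
    to a violation of primitivity. *)
Lemma primitive_unitmx n (M : 'M[Z2]_n) : primitive M -> M \in unitmx.
Proof.
move=> h; rewrite unitmx_red unitmxE unitfE -det_tr.
apply/det0P => -[v v0 vM]; case/eqP: v0; apply: trmx_inj; rewrite trmx0.
have := h (map_mx lift2 v^T); rewrite /evm map_mxM lift2_mxK; apply.
by apply: trmx_inj; rewrite trmx_mul trmxK vM trmx0.
Qed.

Lemma evm_mul m n p (A : 'M[Z2]_(m, n)) (B : 'M[Z2]_(n, p)) :
  evm B -> evm (A *m B).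
Proof. by rewrite /evm map_mxM => ->; rewrite mulmx0. Qed.

(** Gaussian elimination over F_2 writes the transpose of E, of full row rank, as an invertible
    matrix times the upper rows of an invertible [row_ebase]. The lower rows of the latter, lifted
    to Z_2, complete the basis. *)
Lemma primitive_basis m n (E : 'M[Z2]_(m + n, m)) : primitive E ->
  exists F : 'M[Z2]_(m + n, n), row_mx E F \in unitmx.
Proof.
move=> hE; pose A := (map_mx red E)^T.
have rA : row_free A.
  apply/row_freeP; apply: contrapT => nA.
  have : kermx A != 0 by rewrite kermx_eq0; apply: contra_notN nA => /row_freeP.
  case/rowV0Pn => v; rewrite sub_kermx => /eqP vA /eqP; case; apply: trmx_inj.
  have := hE (map_mx lift2 v^T); rewrite /evm map_mxM lift2_mxK trmx0; apply.
  by apply: trmx_inj; rewrite trmx_mul trmxK vA trmx0.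
have eA := mulmx_ebase A; have /eqP rk := rA; rewrite rk in eA.
exists (map_mx lift2 (dsubmx (row_ebase A))^T).
rewrite unitmx_red map_row_mx lift2_mxK -unitmx_tr tr_row_mx trmxK.
rewrite -/A -{1}eA pid_mx_row -[X in _ *m X]vsubmxK -mulmxA mul_row_col mul1mx mul0mx addr0.
have -> : col_mx (col_ebase A *m usubmx (row_ebase A)) (dsubmx (row_ebase A))
        = block_mx (col_ebase A) 0 0 1%:M *m row_ebase A.
  by rewrite -[in RHS](vsubmxK (row_ebase A)) mul_block_col !mul0mx mul1mx addr0 add0r.
rewrite unitmx_mul row_ebase_unit andbT unitmxE det_lblock det1 mulr1.
by rewrite -unitmxE col_ebase_unit.
Qed.

(** * Forms modulo 4 *)

Definition red4 (x : Z2) : 'Z_4 := (z2s x 2)%:~R.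

Lemma modz4Z (m : int) : ((m %% 4)%Z)%:~R = m%:~R :> 'Z_4.
Proof.
rewrite [in RHS](divz_eq m 4); move: (_ %% 4)%Z (_ %/ 4)%Z => r q.
rewrite intrD intrM.
have -> : (4%:~R : 'Z_4) = 0 by apply/eqP; vm_compute.
by rewrite mulr0 add0r.
Qed.

Lemma red4_is_zmod : zmod_morphism red4.
Proof. by move=> x y; rewrite /red4 /= -[pw 2]/(4 : int) modzDmr modz4Z intrB. Qed.

Lemma red4_is_monoid : monoid_morphism red4.
Proof.
split; first by rewrite /red4 /= -[pw 2]/(4 : int) modz4Z.
by move=> x y; rewrite /red4 /= -[pw 2]/(4 : int) modz4Z intrM.
Qed.

HB.instance Definition _ :=
  GRing.isZmodMorphism.Build Z2 'Z_4 red4 red4_is_zmod.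
HB.instance Definition _ :=
  GRing.isMonoidMorphism.Build Z2 'Z_4 red4 red4_is_monoid.

Lemma Z4_four : (4 : 'Z_4) = 0. Proof. by apply/eqP; vm_compute. Qed.

Lemma red4_four x : red4 (4 * x) = 0.
Proof. by rewrite rmorphM rmorph_nat Z4_four mul0r. Qed.

Lemma red4_sq y : red4 (y * y) = (par y)%:R.
Proof.
have [t {1 2}->] := par_exists y.
have -> : ((par y)%:R + 2 * t) * ((par y)%:R + 2 * t)
   = (par y)%:R * (par y)%:R + 4 * ((par y)%:R * t + t * t) :> Z2 by ring.
by rewrite rmorphD /= red4_four addr0 -natrM mulnb andbb rmorph_nat.
Qed.

Lemma red4_dbl x y : red4 (2 * (x * y)) = (2 * (par x && par y))%:R.
Proof.
have [s {1}->] := par_exists x; have [t {1}->] := par_exists y.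
rewrite -mulnb; move: (par x) (par y) => a b.
have -> : 2 * ((a%:R + 2 * s) * (b%:R + 2 * t))
   = (2 * (a * b))%:R + 4 * (a%:R * t + b%:R * s + 2 * s * t) :> Z2.
  by rewrite !natrM; ring.
by rewrite rmorphD /= red4_four addr0 rmorph_nat.
Qed.

Lemma red4P (x : Z2) : exists2 n : nat, (n < 4)%N & red4 x = n%:R /\ par x = odd n.
Proof.
have [s xs] := par_exists x; have [t st] := par_exists s.
exists (par x + 2 * par s)%N; first by case: (par x); case: (par s).
split; last by rewrite oddD oddM addbF; case: (par x).
rewrite {1}xs {1}st.
have -> : (par x)%:R + 2 * ((par s)%:R + 2 * t)
   = (par x + 2 * par s)%:R + 4 * t :> Z2 by rewrite natrD natrM; ring.
by rewrite rmorphD /= red4_four addr0 rmorph_nat.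
Qed.

Lemma red4_nat_eq m n : (m%:R == n%:R :> 'Z_4) = (m == n %[mod 4])%N.
Proof. by rewrite -val_eqE /= !val_Zp_nat. Qed.

(* In the form nf_scal below, if d2 and d3 are even then the norm mod 4 and the
   scalar product mod 2 depend only on the parities of x1, y1, y2, y3: this makes
   representability mod 4 a finite check. *)
Definition bits : Type := bool * bool * bool * bool.

Definition norm4 (e c1 c2 c3 : nat) (u : bits) : nat :=
  let: (x1, y1, y2, y3) := u in
  (2 * (x1 && y1) + e * y1 + c1 * y2 + c2 * (2 * (y2 && y3)) + c3 * y3)%N.

Definition scal2 (e c1 c2 c3 : nat) (u v : bits) : bool :=
  let: (x1, y1, y2, y3) := u in let: (x1', y1', y2', y3') := v in
  (x1 && y1') (+) (y1 && x1') (+) odd e && (y1 && y1') (+)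
  odd c1 && (y2 && y2') (+) odd c2 && ((y2 && y3') (+) (y3 && y2')) (+)
  odd c3 && (y3 && y3').

Definition all_bits : seq bits :=
  [seq (p, b) | p <- [seq (q, c) | q <- [seq (d, e) | d <- [:: true; false],
     e <- [:: true; false]], c <- [:: true; false]], b <- [:: true; false]].

(** Search for the reduction of a basis of T(1, t): u and v of norm 2 mod 4 with odd product, and z
    of norm t mod 4 with even products with u and v. *)
Definition represents_mod4 e c1 c2 c3 t : bool :=
  let q := norm4 e c1 c2 c3 in let b := scal2 e c1 c2 c3 in
  let U := [seq u <- all_bits | q u %% 4 == 2]%N in
  let Z := [seq u <- all_bits | q u %% 4 == t]%N in
  has (fun u => has (fun v => b u v) U && has (fun v => if b u v then
    has (fun z => ~~ b u z && ~~ b v z) Z else false) U) U.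

(** The condition c1 c3 - c2^2 = 2 mod 4, with 3 in place of -1 to stay in [nat]. *)
Definition det_mod4 (c1 c2 c3 : nat) : bool := ((c1 * c3 + 3 * (c2 * c2)) %% 4 == 2)%N.

Lemma mod4_table :
  all (fun e => all (fun c1 => all (fun c2 => all (fun c3 =>
    det_mod4 c1 c2 c3 || ~~ all (represents_mod4 e c1 c2 c3) [:: 1; 2; 3]%N)
  (iota 0 4)) (iota 0 4)) (iota 0 4)) (iota 0 4).
Proof. by vm_compute. Qed.

(** * The normal form of the rank 6 lattice, and its reduction modulo 4 *)

Definition dot (x : 'rV[Z2]_3) (w : 'cV[Z2]_3) : Z2 := (x *m w) 0 0.

Definition nf_gram (d2 d3 e c1 c2 c3 : Z2) (x1 x2 x3 y1 y2 y3 : 'rV[Z2]_3) : 'M[Z2]_3 :=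
  (x1^T *m y1 + y1^T *m x1) + d2 *: (x2^T *m y2 + y2^T *m x2)
  + d3 *: (x3^T *m y3 + y3^T *m x3) + e *: (y1^T *m y1) + c1 *: (y2^T *m y2)
  + c2 *: (y2^T *m y3 + y3^T *m y2) + c3 *: (y3^T *m y3).

Definition even_at (w : 'cV[Z2]_3) (x : 'rV[Z2]_3) : Prop := par (dot x w) = false.

(* A basis e1, e2, e3, f1, f2, f3 of the rank 6 lattice is understood, with
   (e_i, f_i) = 1, d2, d3, the f_i having Gram matrix e + [c1 c2; c2 c3], and all
   other products 0; x_i and y_i are the rows of coordinates along e_i and f_i. *)
Definition nf_rep (d2 d3 e c1 c2 c3 : Z2) (A : 'M[Z2]_3) : Prop :=
  exists x1 x2 x3 y1 y2 y3 : 'rV[Z2]_3,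
    A = nf_gram d2 d3 e c1 c2 c3 x1 x2 x3 y1 y2 y3 /\
    forall w, even_at w x1 -> even_at w x2 -> even_at w x3 ->
              even_at w y1 -> even_at w y2 -> even_at w y3 -> evm w.

Definition nf_scal (d2 d3 e c1 c2 c3 x1 x2 x3 y1 y2 y3 x1' x2' x3' y1' y2' y3' : Z2) : Z2 :=
  (x1 * y1' + y1 * x1') + d2 * (x2 * y2' + y2 * x2')
  + d3 * (x3 * y3' + y3 * x3') + e * (y1 * y1') + c1 * (y2 * y2')
  + c2 * (y2 * y3' + y3 * y2') + c3 * (y3 * y3').

Lemma nf_gramE d2 d3 e c1 c2 c3 x1 x2 x3 y1 y2 y3 i j :
  nf_gram d2 d3 e c1 c2 c3 x1 x2 x3 y1 y2 y3 i j =
  nf_scal d2 d3 e c1 c2 c3 (x1 0 i) (x2 0 i) (x3 0 i) (y1 0 i) (y2 0 i) (y3 0 i)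
     (x1 0 j) (x2 0 j) (x3 0 j) (y1 0 j) (y2 0 j) (y3 0 j).
Proof. by rewrite !mxE !big_ord1 !mxE. Qed.

Lemma nf_gram_eval d2 d3 e c1 c2 c3 x1 x2 x3 y1 y2 y3 (w w' : 'cV_3) :
  (w^T *m nf_gram d2 d3 e c1 c2 c3 x1 x2 x3 y1 y2 y3 *m w') 0 0 =
  nf_scal d2 d3 e c1 c2 c3 (dot x1 w) (dot x2 w) (dot x3 w) (dot y1 w) (dot y2 w) (dot y3 w)
     (dot x1 w') (dot x2 w') (dot x3 w') (dot y1 w') (dot y2 w') (dot y3 w').
Proof.
pose F (M : 'M[Z2]_3) := (w^T *m M *m w') 0 0; rewrite -/(F _).
have FD M N : F (M + N) = F M + F N by rewrite /F mulmxDr mulmxDl mxE.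
have FZ a M : F (a *: M) = a * F M by rewrite /F -scalemxAr -scalemxAl mxE.
have FM (x y : 'rV[Z2]_3) : F (x^T *m y) = dot x w * dot y w'.
  rewrite /F mulmxA -mulmxA -trmx_mul [x *m w]mx11_scalar [y *m w']mx11_scalar.
  by rewrite tr_scalar_mx -scalar_mxM mxE.
by rewrite /nf_gram !FD !FZ !FD !FM.
Qed.

Lemma dotD x y w : dot (x + y) w = dot x w + dot y w.
Proof. by rewrite /dot mulmxDl mxE. Qed.
Lemma dotZ a x w : dot (a *: x) w = a * dot x w.
Proof. by rewrite /dot -scalemxAl mxE. Qed.
Lemma dotN x w : dot (- x) w = - dot x w.
Proof. by rewrite /dot mulNmx mxE. Qed.
Definition dotE := (dotD, dotZ, dotN).

(** The lattice T(a, c) = a A2 + <c>. *)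
Definition test_form (a c : Z2) : 'M[Z2]_3 :=
  \matrix_(i, j) nth 0 (nth [::] [:: [:: 2 * a; a; 0]; [:: a; 2 * a; 0]; [:: 0; 0; c]] i) j.

Definition i0 : 'I_3 := Ordinal (isT : (0 < 3)%N).
Definition i1 : 'I_3 := Ordinal (isT : (1 < 3)%N).
Definition i2 : 'I_3 := Ordinal (isT : (2 < 3)%N).

Lemma test_formE a c :
  ((test_form a c i0 i0 = 2 * a) * (test_form a c i0 i1 = a) *
   (test_form a c i0 i2 = 0) * (test_form a c i1 i0 = a) *
   (test_form a c i1 i1 = 2 * a) * (test_form a c i1 i2 = 0) *
   (test_form a c i2 i0 = 0) * (test_form a c i2 i1 = 0) *
   (test_form a c i2 i2 = c)).
Proof. by rewrite !mxE. Qed.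

Lemma nf_scal_mod4 d2 d3 e c1 c2 c3 x1 x2 x3 y1 y2 y3 (ne n1 n2 n3 : nat) :
    par d2 = false -> par d3 = false -> red4 e = ne%:R -> red4 c1 = n1%:R ->
    red4 c2 = n2%:R -> red4 c3 = n3%:R ->
  red4 (nf_scal d2 d3 e c1 c2 c3 x1 x2 x3 y1 y2 y3 x1 x2 x3 y1 y2 y3) =
  (norm4 ne n1 n2 n3 (par x1, par y1, par y2, par y3))%:R.
Proof.
move=> /par_half [s ->] /par_half [t ->] he h1 h2 h3.
have -> : nf_scal (2 * s) (2 * t) e c1 c2 c3 x1 x2 x3 y1 y2 y3 x1 x2 x3 y1 y2 y3
  = 2 * (x1 * y1) + e * (y1 * y1) + c1 * (y2 * y2) + c2 * (2 * (y2 * y3))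
    + c3 * (y3 * y3) + 4 * (s * (x2 * y2) + t * (x3 * y3)).
  by rewrite /nf_scal; ring.
rewrite rmorphD /= red4_four addr0 4!rmorphD /= red4_dbl.
rewrite !(rmorphM _ e) !(rmorphM _ c1) !(rmorphM _ c2) !(rmorphM _ c3) /=.
rewrite !red4_dbl !red4_sq he h1 h2 h3 /norm4 !natrD !natrM; ring.
Qed.

Lemma nf_scal_mod2 d2 d3 e c1 c2 c3 x1 x2 x3 y1 y2 y3 x1' x2' x3' y1' y2' y3'
    (ne n1 n2 n3 : nat) :
    par d2 = false -> par d3 = false -> par e = odd ne -> par c1 = odd n1 ->
    par c2 = odd n2 -> par c3 = odd n3 ->
  par (nf_scal d2 d3 e c1 c2 c3 x1 x2 x3 y1 y2 y3 x1' x2' x3' y1' y2' y3') =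
  scal2 ne n1 n2 n3 (par x1, par y1, par y2, par y3) (par x1', par y1', par y2', par y3').
Proof.
by move=> p2 p3 pe h1 h2 h3; rewrite /nf_scal !parS p2 p3 pe h1 h2 h3 /= !addbF.
Qed.

Lemma all_bitsP (u : bits) : u \in all_bits.
Proof. by case: u => [[[[] []] []] []]. Qed.

(** The parities of the coordinates of the three basis vectors of T(1, t) solve the search
    [represents_mod4]; by [mod4_table], success for t = 1, 2 and 3 leaves only determinant 2 mod
    4. *)
Lemma nf_mod4_obstruction d2 d3 e c1 c2 c3 :
    par d2 = false -> par d3 = false ->
    (forall c, c != 0 -> nf_rep d2 d3 e c1 c2 c3 (test_form 1 c)) ->
  red4 (c1 * c3 - c2 * c2) = 2.
Proof.
move=> p2 p3 H.
have [ne le [he pe]] := red4P e; have [n1 l1 [h1 p1]] := red4P c1.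
have [n2 l2 [h2 q2]] := red4P c2; have [n3 l3 [h3 q3]] := red4P c3.
have tab := mod4_table.
have iotaP n : (n < 4)%N -> n \in iota 0 4 by rewrite mem_iota.
move/allP/(_ ne (iotaP _ le))/allP/(_ n1 (iotaP _ l1)): tab.
move/allP/(_ n2 (iotaP _ l2))/allP/(_ n3 (iotaP _ l3))/orP => -[D|].
  rewrite rmorphB !rmorphM /= h1 h2 h3.
  have -> : n1%:R * n3%:R - n2%:R * n2%:R =
     (n1 * n3 + 3 * (n2 * n2))%:R - 4 * (n2%:R * n2%:R) :> 'Z_4.
    by rewrite natrD !natrM; ring.
  by rewrite Z4_four mul0r subr0; apply/eqP; rewrite red4_nat_eq.
case/negP; apply/allP => t ht.
have t4 : (t < 4)%N by move: ht; rewrite !inE => /or3P[] /eqP ->.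
have t0 : t%:R != 0 :> Z2.
  apply/eqP => /(congr1 red4) /eqP; rewrite rmorph_nat rmorph0.
  by move: ht; rewrite !inE => /or3P[] /eqP ->.
have [x1 [x2 [x3 [y1 [y2 [y3 [/matrixP E _]]]]]]] := H _ t0.
pose b i : bits := (par (x1 0 i), par (y1 0 i), par (y2 0 i), par (y3 0 i)).
have N i n : test_form 1 t%:R i i = n%:R -> (norm4 ne n1 n2 n3 (b i) == n %[mod 4])%N.
  rewrite E nf_gramE => /(congr1 red4).
  rewrite (nf_scal_mod4 _ _ _ _ _ _ p2 p3 he h1 h2 h3) rmorph_nat => /eqP.
  by rewrite red4_nat_eq.
have S i j : scal2 ne n1 n2 n3 (b i) (b j) = par (test_form 1 t%:R i j).
  by rewrite E nf_gramE (nf_scal_mod2 _ _ _ _ _ _ _ _ _ _ _ _ p2 p3 pe p1 q2 q3).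
have mem i n : (n < 4)%N -> test_form 1 t%:R i i = n%:R ->
    b i \in [seq u <- all_bits | norm4 ne n1 n2 n3 u %% 4 == n]%N.
  by move=> ln /N; rewrite mem_filter all_bitsP andbT (modn_small ln).
apply/hasP; exists (b i0); first by apply: mem; rewrite ?test_formE ?mulr1.
have m1 : b i1 \in [seq u <- all_bits | norm4 ne n1 n2 n3 u %% 4 == 2]%N.
  by apply: mem; rewrite ?test_formE ?mulr1.
apply/andP; split; apply/hasP; exists (b i1) => //.
  by rewrite S test_formE par1.
rewrite S test_formE par1; apply/hasP; exists (b i2).
  by apply: mem; rewrite ?test_formE.
by rewrite !S !test_formE par0.
Qed.

(** * Changes of basis in the normal form *)

Lemma row_entryD (x y : 'rV[Z2]_3) i : (x + y) 0 i = x 0 i + y 0 i.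
Proof. by rewrite mxE. Qed.
Lemma row_entryZ a (x : 'rV[Z2]_3) i : (a *: x) 0 i = a * x 0 i.
Proof. by rewrite mxE. Qed.
Lemma row_entryN (x : 'rV[Z2]_3) i : (- x) 0 i = - x 0 i.
Proof. by rewrite mxE. Qed.
Definition row_entryE := (row_entryD, row_entryZ, row_entryN).

Ltac nf_ring x1 x2 x3 y1 y2 y3 :=
  let i := fresh "i" in let j := fresh "j" in
  apply/matrixP; intros i j; rewrite [LHS]nf_gramE [RHS]nf_gramE ?row_entryE;
  generalize (x1 0 i) (x2 0 i) (x3 0 i) (y1 0 i) (y2 0 i) (y3 0 i)
             (x1 0 j) (x2 0 j) (x3 0 j) (y1 0 j) (y2 0 j) (y3 0 j);
  rewrite /nf_scal ?(mul0r, addr0) => *; ring.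

Lemma nf_swap12 d3 e c1 c3 A :
  nf_rep 1 d3 e c1 0 c3 A -> nf_rep 1 d3 c1 e 0 c3 A.
Proof.
move=> [x1 [x2 [x3 [y1 [y2 [y3 [-> P]]]]]]]; exists x2, x1, x3, y2, y1, y3.
split; last by move=> w *; apply: P.
nf_ring x1 x2 x3 y1 y2 y3.
Qed.

Lemma nf_swap13 e c1 c3 A :
  nf_rep 1 1 e c1 0 c3 A -> nf_rep 1 1 c3 c1 0 e A.
Proof.
move=> [x1 [x2 [x3 [y1 [y2 [y3 [-> P]]]]]]]; exists x3, x2, x1, y3, y2, y1.
split; last by move=> w *; apply: P.
nf_ring x1 x2 x3 y1 y2 y3.
Qed.

(** With e = 2t, the vector f1 is replaced by f1 - t e1, which is isotropic. *)
Lemma nf_clear_e d2 d3 e c1 c2 c3 A : par e = false ->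
  nf_rep d2 d3 e c1 c2 c3 A -> nf_rep d2 d3 0 c1 c2 c3 A.
Proof.
move=> /par_half [t ->] [x1 [x2 [x3 [y1 [y2 [y3 [-> P]]]]]]].
exists (x1 + t *: y1), x2, x3, y1, y2, y3; split.
  nf_ring x1 x2 x3 y1 y2 y3.
move=> w; rewrite /even_at !dotE !parS => h1 h2 h3 h4 h5 h6.
by apply: P => //; move: h1; rewrite h4 andbF addbF.
Qed.

(** The vector f1 is replaced by f1 + f2, of norm e + c1. To keep e2, f2, f3 orthogonal to it, the
    multiples d2 e1, c1 e1, c2 e1 are subtracted from them. *)
Lemma nf_add_f2 d2 d3 e c1 c2 c3 A :
  nf_rep d2 d3 e c1 c2 c3 A -> nf_rep d2 d3 (e + c1) c1 c2 c3 A.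
Proof.
move=> [x1 [x2 [x3 [y1 [y2 [y3 [-> P]]]]]]].
exists (x1 + d2 *: x2 + - c1 *: y1 + c1 *: y2 + c2 *: y3), x2, x3, y1, (y2 - y1), y3; split.
  nf_ring x1 x2 x3 y1 y2 y3.
move=> w; rewrite /even_at !dotE !parS => h1 h2 h3 h4 h5 h6.
have {}h5 : par (dot y2 w) = false by rewrite h4 addbF in h5.
by apply: P => //; move: h1; rewrite h2 h4 h5 h6 !andbF !addbF.
Qed.

Lemma nf_add_f3 d2 d3 e c1 c2 c3 A :
  nf_rep d2 d3 e c1 c2 c3 A -> nf_rep d2 d3 (e + c3) c1 c2 c3 A.
Proof.
move=> [x1 [x2 [x3 [y1 [y2 [y3 [-> P]]]]]]].
exists (x1 + d3 *: x3 + - c3 *: y1 + c3 *: y3 + c2 *: y2), x2, x3, y1, y2, (y3 - y1); split.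
  nf_ring x1 x2 x3 y1 y2 y3.
move=> w; rewrite /even_at !dotE !parS => h1 h2 h3 h4 h5 h6.
have {}h6 : par (dot y3 w) = false by rewrite h4 addbF in h6.
by apply: P => //; move: h1; rewrite h3 h4 h5 h6 !andbF !addbF.
Qed.

Lemma nf_clear_e_odd d2 d3 e c1 c2 c3 A : par c1 || par c3 ->
  nf_rep d2 d3 e c1 c2 c3 A -> nf_rep d2 d3 0 c1 c2 c3 A.
Proof.
case pe: (par e); last by move=> _; apply: nf_clear_e.
case/orP => pc h.
  by apply: nf_clear_e (nf_add_f2 h); rewrite parD pe pc.
by apply: nf_clear_e (nf_add_f3 h); rewrite parD pe pc.
Qed.

(** Because (e2, f2) = 1, the vector f3 - c2 e2 is orthogonal to f2. *)
Lemma nf_clear_c2 d3 e c1 c2 c3 A :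
  nf_rep 1 d3 e c1 c2 c3 A -> nf_rep 1 d3 e c1 0 c3 A.
Proof.
move=> [x1 [x2 [x3 [y1 [y2 [y3 [-> P]]]]]]].
exists x1, (x2 + c2 *: y3), x3, y1, y2, y3; split.
  nf_ring x1 x2 x3 y1 y2 y3.
move=> w; rewrite /even_at !dotE !parS => h1 h2 h3 h4 h5 h6.
by apply: P => //; move: h2; rewrite h6 andbF addbF.
Qed.

Lemma nf_unit_d3 d3 e c1 c3 A : par d3 ->
  nf_rep 1 d3 e c1 0 c3 A -> nf_rep 1 1 e c1 0 c3 A.
Proof.
move=> pd [x1 [x2 [x3 [y1 [y2 [y3 [-> P]]]]]]].
exists x1, x2, (d3 *: x3), y1, y2, y3; split.
  nf_ring x1 x2 x3 y1 y2 y3.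
move=> w; rewrite /even_at !dotE !parS pd /= => h1 h2 h3 h4 h5 h6.
exact: P.
Qed.

(** * Cancellation of the plane A2 *)

Definition A2 (a b a' b' : Z2) : Z2 := 2 * a * a' + a * b' + b * a' + 2 * b * b'.

(* Witt cancellation of the plane A2: if p is the block of an isometry of
   A2 + N mapping A2 to itself and h is an isometry of A2 with h - p invertible,
   then s + r (h - p)^-1 q has the same norm as the vector s + q. Every
   matrix p over F_2 admits such an h, as O(A2) maps onto GL_2(F_2). *)
Lemma A2_cancel (a b c d p q n : Z2) :
  exists m1 m2 : Z2,
    (n - A2 p q p q) - 2 * m1 * A2 a b p q - 2 * m2 * A2 c d p q
     + m1 * m1 * (2 - A2 a b a b) + 2 * m1 * m2 * (1 - A2 a b c d)
     + m2 * m2 * (2 - A2 c d c d) = n /\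
    (par (- A2 a b p q + m1 * (2 - A2 a b a b) + m2 * (1 - A2 a b c d)) = false ->
     par (- A2 c d p q + m1 * (1 - A2 a b c d) + m2 * (2 - A2 c d c d)) = false ->
     par (p + m1 * a + m2 * c) = false /\ par (q + m1 * b + m2 * d) = false).
Proof.
(* Cramer's rule for (h - P) m = (p, q), where P has the columns (a, b) and (c, d). *)
have solve h11 h21 h12 h22 : par ((h11 - a) * (h22 - d) - (h12 - c) * (h21 - b)) ->
  exists m1 m2 : Z2, p = h11 * m1 + h12 * m2 - a * m1 - c * m2 /\
                     q = h21 * m1 + h22 * m2 - b * m1 - d * m2.
  move=> /par_inv_ex [t tD].
  exists (t * ((h22 - d) * p - (h12 - c) * q)), (t * ((h11 - a) * q - (h21 - b) * p)).
  by split; rewrite -[LHS]mul1r -{}tD; ring.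
(* The list has one isometry of A2, given by columns, over each of the six elements of GL_2(F_2). *)
have [h11 [h21 [h12 [h22 [hh od]]]]] : exists h11 h21 h12 h22 : Z2,
    ((h11, h21, h12, h22) \in [:: (1, 0, 0, 1); (0, 1, 1, 0); (0, 1, -1, 1);
       (-1, 1, -1, 0); (1, 0, 1, -1); (1, -1, 0, -1)]) /\
    par ((h11 - a) * (h22 - d) - (h12 - c) * (h21 - b)).
  have od h11 h21 h12 h22 : par ((h11 - a) * (h22 - d) - (h12 - c) * (h21 - b)) =
    (par h11 (+) par a) && (par h22 (+) par d) (+)
    (par h12 (+) par c) && (par h21 (+) par b) by rewrite !parS.
  have : [|| (~~ par a && ~~ par d) (+) par c && par b,
             par a && par d (+) (~~ par c && ~~ par b),
             par a && ~~ par d (+) (~~ par c && ~~ par b),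
             ~~ par a && par d (+) (~~ par c && ~~ par b),
             (~~ par a && ~~ par d) (+) (~~ par c && par b) |
             (~~ par a && ~~ par d) (+) (par c && ~~ par b)].
    by case: (par a); case: (par b); case: (par c); case: (par d).
  by case/orP => [h|/orP[h|/orP[h|/orP[h|/orP[h|h]]]]];
   [exists 1, 0, 0, 1 | exists 0, 1, 1, 0 | exists 0, 1, (-1), 1
   |exists (-1), 1, (-1), 0 | exists 1, 0, 1, (-1) | exists 1, (-1), 0, (-1)];
   (split; first by rewrite !inE eqxx ?orbT);
   rewrite od !parS; move: h; case: (par a); case: (par b); case: (par c); case: (par d).
have [m1 [m2 [pE qE]]] := solve _ _ _ _ od.
exists m1, m2; move: od; rewrite pE qE /A2; move: hh; rewrite !inE => {pE qE solve}.
by case/orP => [|/orP[|/orP[|/orP[|/orP[|]]]]] /eqP[-> -> -> ->] od;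
  (split; first by ring); move: od; rewrite !parS;
  case: (par a); case: (par b); case: (par c); case: (par d); case: (par m1); case: (par m2).
Qed.

(** If k > 0, then y is even, hence so are a and b, and dividing by 4 gives the equation for k - 1
    with the same x. If k = 0, the right side is odd, so y is odd and x even. *)
Lemma anisotropic_descent k (u g a b x y : Z2) : par u -> par g ->
  - 2 * (a * a + a * b + b * b) + 2 ^+ k * u * x * y + g * y * y = 2 ^+ k * u * (2 ^+ k * u) ->
  par x = false.
Proof.
move=> pu pg; elim: k a b y => [|k IH] a b y.
  rewrite mul1r => /(congr1 par); rewrite !parS pu pg /=.
  by case: (par x); case: (par y).
rewrite exprS => E.
have /par_half [y' yE] : par y = false.
  by move/(congr1 par): E; rewrite !parS pg /=; case: (par y).
have E1 : a * a + a * b + b * b =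
   2 * (2 ^+ k * u * x * y' + g * y' * y' - 2 ^+ k * u * (2 ^+ k * u)).
  apply: (mulfI z2_two_neq0); move: E; rewrite yE => /eqP; rewrite -subr_eq0 => /eqP E.
  apply/eqP; rewrite -subr_eq0; apply/eqP.
  by rewrite -[RHS]oppr0 -E; ring.
have [pa pb] : par a = false /\ par b = false.
  by move/(congr1 par): E1; rewrite !parS /=; case: (par a); case: (par b).
move: pa pb E1 => /par_half [a' ->] /par_half [b' ->] E1.
apply: (IH a' b' y'); apply: (mulfI z2_two_neq0); apply/eqP; rewrite -subr_eq0.
apply/eqP; rewrite -[RHS](subrr (2 * a' * (2 * a') + 2 * a' * (2 * b') + 2 * b' * (2 * b'))).
by rewrite {1}E1; ring.
Qed.

(** The left side is the norm of a vector of -A2 + [0 d; d g]: no vector of norm 4 d^2 there is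
    primitive. Parity settles y, a and b; one division by 4 leads to [anisotropic_descent] for x. *)
Lemma anisotropic_even (d g a b x y : Z2) : d != 0 -> par g ->
    - 2 * (a * a + a * b + b * b) + 2 * d * x * y + g * y * y = 4 * d * d ->
  [/\ par a = false, par b = false, par x = false & par y = false].
Proof.
move=> /z2_valuation [k [u [-> pu]]] pg E.
have py : par y = false.
  by move/(congr1 par): E; rewrite !parS pg /=; case: (par y).
have /par_half [y' yE] := py; rewrite yE in E.
have E1 : a * a + a * b + b * b =
   2 * (2 ^+ k * u * x * y' + g * y' * y' - 2 ^+ k * u * (2 ^+ k * u)).
  apply: (mulfI z2_two_neq0); move: E => /eqP; rewrite -subr_eq0 => /eqP E.
  apply/eqP; rewrite -subr_eq0; apply/eqP.
  by rewrite -[RHS]oppr0 -E; ring.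
have [pa pb] : par a = false /\ par b = false.
  by move/(congr1 par): E1; rewrite !parS /=; case: (par a); case: (par b).
split=> //; move: pa pb E1 => /par_half [a' ->] /par_half [b' ->] E1.
apply: (@anisotropic_descent k u g a' b' x y' pu pg).
apply: (mulfI z2_two_neq0); apply/eqP; rewrite -subr_eq0.
apply/eqP; rewrite -[RHS](subrr (2 * a' * (2 * a') + 2 * a' * (2 * b') + 2 * b' * (2 * b'))).
by rewrite {1}E1; ring.
Qed.

Lemma sum3 (F : 'I_3 -> Z2) : \sum_(i < 3) F i = F i0 + F i1 + F i2.
Proof.
rewrite !big_ord_recl big_ord0 addr0 addrA.
by congr (F _ + F _ + F _); apply: val_inj.
Qed.

Lemma dot3 x w : dot x w = x 0 i0 * w i0 0 + x 0 i1 * w i1 0 + x 0 i2 * w i2 0.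
Proof. by rewrite /dot mxE sum3. Qed.

Lemma dot_delta x i : dot x (delta_mx i 0) = x 0 i.
Proof.
rewrite /dot mxE (bigD1 i) //= big1 ?mxE ?eqxx ?mulr1 ?addr0 // => j /negPf ji.
by rewrite mxE ji mulr0.
Qed.

Lemma test_form_eval a c (w w' : 'cV_3) : (w^T *m test_form a c *m w') 0 0 =
  a * A2 (w i0 0) (w i1 0) (w' i0 0) (w' i1 0) + c * (w i2 0 * w' i2 0).
Proof.
rewrite mxE sum3 [in X in X + _ + _]mxE [in X in _ + X + _]mxE [in X in _ + _ + X]mxE !sum3.
rewrite !test_formE ![w^T _ _]mxE.
move: (w i0 0) (w i1 0) (w i2 0) (w' i0 0) (w' i1 0) (w' i2 0) => *.
by rewrite /A2 ?(mulr0, addr0, add0r); ring.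
Qed.

Definition col3 (a b c : Z2) : 'cV[Z2]_3 := \col_i nth 0 [:: a; b; c] i.

(** The lattice H + H + [0 d; d g] is A2 + N with N = -A2 + [0 d; d g]. Cancelling the A2 of T(1, 4
    d^2) yields a vector of norm 4 d^2 in N, which cannot be primitive; this makes the image of (m1,
    m2, 1) even. *)
Lemma nf_odd_core (d g : Z2) x10 x20 x30 y10 y20 y30 x11 x21 x31 y11 y21 y31
    x12 x22 x32 y12 y22 y32 :
    d != 0 -> par g ->
    nf_scal 1 d 0 0 0 g x10 x20 x30 y10 y20 y30 x10 x20 x30 y10 y20 y30 = 2 ->
    nf_scal 1 d 0 0 0 g x10 x20 x30 y10 y20 y30 x11 x21 x31 y11 y21 y31 = 1 ->
    nf_scal 1 d 0 0 0 g x11 x21 x31 y11 y21 y31 x11 x21 x31 y11 y21 y31 = 2 ->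
    nf_scal 1 d 0 0 0 g x10 x20 x30 y10 y20 y30 x12 x22 x32 y12 y22 y32 = 0 ->
    nf_scal 1 d 0 0 0 g x11 x21 x31 y11 y21 y31 x12 x22 x32 y12 y22 y32 = 0 ->
    nf_scal 1 d 0 0 0 g x12 x22 x32 y12 y22 y32 x12 x22 x32 y12 y22 y32 = 4 * d * d ->
  exists m1 m2,
    [/\ par (x10 * m1 + x11 * m2 + x12) = false,
        par (x20 * m1 + x21 * m2 + x22) = false &
        par (x30 * m1 + x31 * m2 + x32) = false] /\
    [/\ par (y10 * m1 + y11 * m2 + y12) = false,
        par (y20 * m1 + y21 * m2 + y22) = false &
        par (y30 * m1 + y31 * m2 + y32) = false].
Proof.
move=> d0 pg; rewrite /nf_scal !(mul0r, addr0, mul1r).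
(* H + H = A2 + (-A2), with basis (1,1,0,0), (0,1,1,1), (1,-1,-1,0), (0,0,-1,1)
   in the coordinates x1, y1, x2, y2; the index is 9, hence a unit. *)
have split_HH (x1 y1 x2 y2 : Z2) : exists p1 p2 r1 r2,
    [/\ x1 = p1 + r1, y1 = p1 + p2 - r1, x2 = p2 - r1 - r2 & y2 = p2 + r2].
  have [t t3] := @par_inv_ex 3 (par_nat 3).
  pose p1 := t * (2 * (x1 + y1) - (x1 + x2 + y2)).
  pose p2 := t * (2 * (x1 + x2 + y2) - (x1 + y1)).
  exists p1, p2, (x1 - p1), (y2 - p2).
  split; [by rewrite addrC subrK | | | by rewrite addrC subrK].
    have -> : p1 + p2 - (x1 - p1) = t * 3 * (x1 + y1) - x1 by rewrite /p1 /p2; ring.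
    by rewrite t3; ring.
  have -> : p2 - (x1 - p1) - (y2 - p2) = t * 3 * (x1 + x2 + y2) - x1 - y2.
    by rewrite /p1 /p2; ring.
  by rewrite t3; ring.
have [a0 [b0 [r0 [s0 [-> -> -> ->]]]]] := split_HH x10 y10 x20 y20.
have [a1 [b1 [r1 [s1 [-> -> -> ->]]]]] := split_HH x11 y11 x21 y21.
have [a2 [b2 [r2 [s2 [-> -> -> ->]]]]] := split_HH x12 y12 x22 y22.
pose N (r s x y r' s' x' y' : Z2) : Z2 := - A2 r s r' s' + d * (x * y' + y * x') + g * (y * y').
have gramE (a b r s x y a' b' r' s' x' y' n : Z2) :
    (a + r) * (a' + b' - r') + (a + b - r) * (a' + r') +
    ((b - r - s) * (b' + s') + (b + s) * (b' - r' - s')) + d * (x * y' + y * x') +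
    g * (y * y') = n ->
    N r s x y r' s' x' y' = n - A2 a b a' b'.
  by move=> <-; rewrite /N /A2; ring.
have N_even r s x y r' s' x' y' : par r' = false -> par s' = false ->
    par x' = false -> par y' = false -> par (N r s x y r' s' x' y') = false.
  by move=> h1 h2 h3 h4; rewrite /N /A2 !parS h1 h2 h3 h4 !andbF.
move=> /gramE E00 /gramE E01 /gramE E11 /gramE E02 /gramE E12 /gramE E22.
(* By cancellation the N-component of the image of (m1, m2, 1) has norm 4 d^2, so it is even. *)
have [m1 [m2 [nE pE]]] := A2_cancel a0 b0 a1 b1 a2 b2 (4 * d * d).
have := @anisotropic_even d g (r0 * m1 + r1 * m2 + r2) (s0 * m1 + s1 * m2 + s2)
  (x30 * m1 + x31 * m2 + x32) (y30 * m1 + y31 * m2 + y32) d0 pg.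
case=> [|pr ps px py].
  rewrite -nE -E22 -E00 -E01 -E11.
  have -> : 2 * m1 * A2 a0 b0 a2 b2 = - (2 * m1 * N r0 s0 x30 y30 r2 s2 x32 y32).
    by rewrite E02; ring.
  have -> : 2 * m2 * A2 a1 b1 a2 b2 = - (2 * m2 * N r1 s1 x31 y31 r2 s2 x32 y32).
    by rewrite E12; ring.
  by rewrite /N /A2; ring.
(* An even N-component has even products with the N-components of the first two vectors, and [pE]
   then makes the A2-component even too. *)
have [||qa qb] := pE.
- rewrite -E00 -E01 -[- A2 _ _ _ _]add0r -E02.
  have -> : N r0 s0 x30 y30 r2 s2 x32 y32 + m1 * N r0 s0 x30 y30 r0 s0 x30 y30 +
            m2 * N r0 s0 x30 y30 r1 s1 x31 y31 =
     N r0 s0 x30 y30 (r0 * m1 + r1 * m2 + r2) (s0 * m1 + s1 * m2 + s2)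
       (x30 * m1 + x31 * m2 + x32) (y30 * m1 + y31 * m2 + y32).
    by rewrite /N /A2; ring.
  exact: N_even.
- rewrite -E11 -E01 -[- A2 _ _ _ _]add0r -E12.
  have -> : N r1 s1 x31 y31 r2 s2 x32 y32 + m1 * N r0 s0 x30 y30 r1 s1 x31 y31 +
            m2 * N r1 s1 x31 y31 r1 s1 x31 y31 =
     N r1 s1 x31 y31 (r0 * m1 + r1 * m2 + r2) (s0 * m1 + s1 * m2 + s2)
       (x30 * m1 + x31 * m2 + x32) (y30 * m1 + y31 * m2 + y32).
    by rewrite /N /A2; ring.
  exact: N_even.
exists m1, m2; move: pr ps px py qa qb.
set R := r0 * m1 + r1 * m2 + r2; set S := s0 * m1 + s1 * m2 + s2.
set A := a2 + m1 * a0 + m2 * a1; set B := b2 + m1 * b0 + m2 * b1.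
move=> pr ps px py qa qb; split; split => //.
- have -> : (a0 + r0) * m1 + (a1 + r1) * m2 + (a2 + r2) = A + R by rewrite /A /R; ring.
  by rewrite parD qa pr.
- have -> : (b0 - r0 - s0) * m1 + (b1 - r1 - s1) * m2 + (b2 - r2 - s2) = B - R - S.
    by rewrite /B /R /S; ring.
  by rewrite 2!parD 2!parN qb pr ps.
- have -> : (a0 + b0 - r0) * m1 + (a1 + b1 - r1) * m2 + (a2 + b2 - r2) = A + B - R.
    by rewrite /A /B /R; ring.
  by rewrite 2!parD parN qa qb pr.
have -> : (b0 + s0) * m1 + (b1 + s1) * m2 + (b2 + s2) = B + S by rewrite /B /S; ring.
by rewrite parD qb ps.
Qed.

Lemma nf_odd_obstruction d g : d != 0 -> par g ->
  ~ nf_rep 1 d 0 0 0 g (test_form 1 (4 * d * d)).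
Proof.
move=> d0 pg [x1 [x2 [x3 [y1 [y2 [y3 [/matrixP E P]]]]]]].
have nE i j := etrans (esym (nf_gramE 1 d 0 0 0 g x1 x2 x3 y1 y2 y3 i j)) (esym (E i j)).
have [||||||m1 [m2 [[p1 p2 p3] [q1 q2 q3]]]] := @nf_odd_core d g
  (x1 0 i0) (x2 0 i0) (x3 0 i0) (y1 0 i0) (y2 0 i0) (y3 0 i0)
  (x1 0 i1) (x2 0 i1) (x3 0 i1) (y1 0 i1) (y2 0 i1) (y3 0 i1)
  (x1 0 i2) (x2 0 i2) (x3 0 i2) (y1 0 i2) (y2 0 i2) (y3 0 i2) d0 pg;
  do ?[by rewrite nE test_formE ?mulr1].
have ev x : even_at (col3 m1 m2 1) x <->
    par (x 0 i0 * m1 + x 0 i1 * m2 + x 0 i2) = false.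
  by rewrite /even_at dot3 !mxE /= mulr1.
have /evmP /(_ i2 0) : evm (col3 m1 m2 1) by apply: P; apply/ev.
by rewrite mxE par1.
Qed.

(** * The remaining cases with b = 0 *)

Lemma red4_half x (b : bool) : red4 x = (2 * b)%:R -> exists y, x = 2 * y /\ par y = b.
Proof.
move=> xb; have [n _ [/esym xn px]] := red4P x.
have e : (n == 2 * b %[mod 4])%N by rewrite -red4_nat_eq xn xb.
have [y xy] : exists y, x = 2 * y.
  apply: par_half; rewrite px; move/eqP/(congr1 odd): e.
  by rewrite !odd_mod // oddM.
exists y; split=> //; move/eqP: xb.
rewrite xy -[y in 2 * y]mulr1 red4_dbl par1 andbT red4_nat_eq.
by case: (par y); case: b {e}.
Qed.

(** A vector of norm 2 has y2 even and x1, y1 odd. Two such vectors have an even product, while the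
    product in A2 is 1. *)
Lemma nf_even_obstruction d c1 c3 c : par d = false -> par c1 -> red4 c3 = 0 ->
  ~ nf_rep 1 d 0 c1 0 c3 (test_form 1 c).
Proof.
move=> /par_half [d' dE] pc1 /(@red4_half _ false) [c3' [cE /par_half [c4 c4E]]].
move=> [x1 [x2 [x3 [y1 [y2 [y3 [/matrixP E _]]]]]]].
have nE i j := etrans (esym (nf_gramE 1 d 0 c1 0 c3 x1 x2 x3 y1 y2 y3 i j)) (esym (E i j)).
have key (a1 a2 a3 b1 b2 b3 : Z2) :
    nf_scal 1 d 0 c1 0 c3 a1 a2 a3 b1 b2 b3 a1 a2 a3 b1 b2 b3 = 2 ->
    [/\ par b2 = false, par a1 & par b1].
  rewrite /nf_scal dE cE c4E !(mul0r, addr0, mul1r) => q.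
  have pb : par b2 = false.
    by move/(congr1 par): q; rewrite !parS pc1 /=; case: (par b2); case: (par a1); case: (par b1);
       case: (par a2).
  have /par_half [t tE] := pb.
  have : 1 = a1 * b1 + 2 * (a2 * t + d' * (a3 * b3) + c1 * t * t + c4 * b3 * b3).
    by apply: (mulfI z2_two_neq0); rewrite mulr1 -[LHS]q tE; ring.
  move/(congr1 par); rewrite par1 parD parM par_dbl addbF.
  by case: (par a1); case: (par b1).
have q0 := nE i0 i0; rewrite test_formE mulr1 in q0.
have q1 := nE i1 i1; rewrite test_formE mulr1 in q1.
have [[p0 a0 b0] [p1 a1 b1]] := (key _ _ _ _ _ _ q0, key _ _ _ _ _ _ q1).
have /(congr1 par) := nE i0 i1; rewrite test_formE par1 /nf_scal dE cE.
by rewrite !parS p0 a0 b0 p1 a1 b1 /= !andbF.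
Qed.

Lemma nf_even_form_obstruction d e c1 c3 : par e = false -> par c1 = false ->
  par c3 = false -> ~ nf_rep 1 d e c1 0 c3 (test_form 1 1).
Proof.
move=> pe p1 p3 [x1 [x2 [x3 [y1 [y2 [y3 [/matrixP /(_ i2 i2) E _]]]]]]].
move: E; rewrite nf_gramE test_formE => /(congr1 par).
rewrite /nf_scal !parS pe p1 p3.
rewrite (andbC (par (y1 0 i2))) (andbC (par (y2 0 i2))) (andbC (par (y3 0 i2))).
by rewrite !addbb !andbF.
Qed.

(** The rows form a matrix invertible over F_2; the columns of its inverse W are the basis dual to
    x1, x2, x3. *)
Lemma unit_rows x1 x2 x3 :
    (forall w, even_at w x1 -> even_at w x2 -> even_at w x3 -> evm w) ->
  exists2 W : 'M[Z2]_3, W \in unitmx & forall j,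
    [/\ dot x1 (col j W) = (j == i0)%:R, dot x2 (col j W) = (j == i1)%:R &
        dot x3 (col j W) = (j == i2)%:R].
Proof.
move=> P; pose M : 'M[Z2]_3 := \matrix_(i, j) nth 0 [:: x1 0 j; x2 0 j; x3 0 j] i.
have ME w : [/\ (M *m w) i0 0 = dot x1 w, (M *m w) i1 0 = dot x2 w &
               (M *m w) i2 0 = dot x3 w].
  by split; rewrite /dot !mxE; apply: eq_bigr => k _; rewrite !mxE.
have uM : M \in unitmx.
  apply: primitive_unitmx => w /evmP Mw; have [e1 e2 e3] := ME w.
  by apply: P; rewrite /even_at ?(=^~ e1, =^~ e2, =^~ e3) Mw.
exists (invmx M); first by rewrite unitmx_inv.
move=> j; have [<- <- <-] := ME (col j (invmx M)).
by rewrite colE mulKVmx // !mxE eqxx !andbT !(eq_sym j).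
Qed.

(** All products in T(2, 8) are even, so y2 is even everywhere; norms mod 4 then make y3 even where
    x1 is. Hence x1, x2, x3 alone detect evenness, and their dual basis vectors s and r, where x1
    vanishes, turn out to be dependent mod 2. *)
Lemma nf_2mod4_sub d c1 g x1 x2 x3 y1 y2 y3 :
    par d = false -> par c1 -> par g ->
    test_form 2 8 = nf_gram 1 d 0 c1 0 (2 * g) x1 x2 x3 y1 y2 y3 ->
    (forall w, even_at w x1 -> even_at w x2 -> even_at w x3 ->
               even_at w y1 -> even_at w y2 -> even_at w y3 -> evm w) ->
    (forall w, even_at w x1 -> even_at w y1) -> False.
Proof.
move=> /par_half [d' ->] pc1 pg E P H.
have S w w' : nf_scal 1 (2 * d') 0 c1 0 (2 * g)
     (dot x1 w) (dot x2 w) (dot x3 w) (dot y1 w) (dot y2 w) (dot y3 w)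
     (dot x1 w') (dot x2 w') (dot x3 w') (dot y1 w') (dot y2 w') (dot y3 w')
   = 2 * A2 (w i0 0) (w i1 0) (w' i0 0) (w' i1 0) + 8 * (w i2 0 * w' i2 0).
  by rewrite -nf_gram_eval -E test_form_eval.
have Y2 w : even_at w y2.
  have /(congr1 par) := S w w; rewrite /even_at /nf_scal /A2 !parS pc1 /=.
  by case: (par (dot y2 w)); case: (par (dot x2 w)); case: (par (dot x1 w)); case: (par (dot y1 w)).
have Y3 w : even_at w x1 -> even_at w y3.
  move=> h; have /par_half [a aE] := h; have /par_half [b bE] := H w h.
  have /par_half [t tE] := Y2 w; have := S w w.
  rewrite /even_at /nf_scal aE bE tE !(mul0r, addr0, mul1r).
  move: (dot x2 w) (dot x3 w) (dot y3 w) (w i0 0) (w i1 0) (w i2 0) => p q r u v z F.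
  have : g * r * r = 2 * (u * u + u * v + v * v + 2 * z * z - 2 * a * b - p * t
                          - c1 * t * t - d' * q * r).
    apply: (mulfI z2_two_neq0); apply/eqP; rewrite -subr_eq0.
    move/eqP: F; rewrite -subr_eq0 => /eqP F; apply/eqP; rewrite -[RHS]F /A2; ring.
  by move/(congr1 par); rewrite !parM pg par_nat /=; case: (par r).
have [w h1 h2 h3|W uW WE] := @unit_rows x1 x2 x3; first by apply: P; auto.
have [a1 a2 a3] := WE i1; have [b1 b2 b3] := WE i2.
rewrite /= in a1 a2 a3 b1 b2 b3.
set s := col i1 W in a1 a2 a3; set r := col i2 W in b1 b2 b3.
have ev x : dot x1 x = 0 -> even_at x x1 by rewrite /even_at => ->; rewrite par0.
have /par_half [t tE] := Y2 s; have /par_half [t' tE'] := Y2 r.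
have /par_half [h hE] := Y3 s (ev _ a1); have /par_half [h' hE'] := Y3 r (ev _ b1).
have := (S s s, S r r, S s r); rewrite /nf_scal a1 a2 a3 b1 b2 b3 tE tE' hE hE'.
rewrite !(mul0r, mulr0, addr0, add0r, mul1r, mulr1) => -[[F1 F2] F3].
move: (dot3 x2 s) (dot3 x3 s) (dot3 x3 r); rewrite a2 a3 b3.
move: (s i0 0) (s i1 0) (s i2 0) (r i0 0) (r i1 0) (r i2 0) F1 F2 F3 => u v z u' v' z' F1 F2 F3.
have cancel4 (X Y : Z2) : 4 * X = 4 * Y -> X = Y.
  move=> XY; apply: (mulfI z2_two_neq0); apply: (mulfI z2_two_neq0).
  by rewrite !mulrA -natrM.
have G1 : u * u + u * v + v * v = t + c1 * t * t + 2 * (g * h * h - z * z).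
  by apply: cancel4; move/eqP: F1; rewrite -subr_eq0 => /eqP F1; apply/eqP;
     rewrite -subr_eq0 -oppr_eq0; apply/eqP; rewrite -[RHS]F1 /A2; ring.
have G2 : u' * u' + u' * v' + v' * v' = c1 * t' * t' + 2 * (d' * h' + g * h' * h' - z' * z').
  by apply: cancel4; move/eqP: F2; rewrite -subr_eq0 => /eqP F2; apply/eqP;
     rewrite -subr_eq0 -oppr_eq0; apply/eqP; rewrite -[RHS]F2 /A2; ring.
have G3 : A2 u v u' v' = t' + 2 * (c1 * t * t' + d' * h + 2 * g * h * h' - 2 * z * z').
  apply: (mulfI z2_two_neq0); move/eqP: F3; rewrite -subr_eq0 => /eqP F3; apply/eqP;
     rewrite -subr_eq0 -oppr_eq0; apply/eqP; rewrite -[RHS]F3; ring.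
(* Modulo 2, [G1] gives u = v = 0, then [G3] gives t' = 0 and [G2] gives u' = v' = 0. So s and r are
   multiples of the third basis vector mod 2, against x2(s) = x3(r) = 1 and x3(s) = 0. *)
move/(congr1 par): G1; move/(congr1 par): G2; move/(congr1 par): G3.
rewrite /A2 !parS pc1 /= !addbF.
move=> g3 g2 g1 /(congr1 par) k1 /(congr1 par) k2 /(congr1 par) k3.
move: k1 k2 k3 g1 g2 g3; rewrite !parS /=.
case: (par u); case: (par v); case: (par t) => //=;
case: (par u'); case: (par v'); case: (par t') => //=; rewrite !andbF /=;
by case: (par z); case: (par z'); case: (par (x3 0 i2)); case: (par (x2 0 i2)).
Qed.

Lemma nf_gram_swap d2 d3 c1 c2 c3 x1 x2 x3 y1 y2 y3 :
  nf_gram d2 d3 0 c1 c2 c3 x1 x2 x3 y1 y2 y3 =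
  nf_gram d2 d3 0 c1 c2 c3 y1 x2 x3 x1 y2 y3.
Proof. by nf_ring x1 x2 x3 y1 y2 y3. Qed.

Lemma nf_hyperbolic_dichotomy (x1 y1 : 'rV[Z2]_3) :
    (forall w j, even_at w x1 -> par (x1 0 j) -> even_at w y1) ->
  (forall w, even_at w x1 -> even_at w y1) \/ (forall w, even_at w y1 -> even_at w x1).
Proof.
move=> h; have [[j pj]|n] := pselect (exists j, par (x1 0 j)).
  by left=> w hw; apply: h hw pj.
right=> w _; have z j : par (x1 0 j) = false.
  by apply/negbTE/negP => pj; apply: n; exists j.
by rewrite /even_at dot3 !parS !z.
Qed.

Lemma nf_2mod4_obstruction d c1 c3 : par d = false -> par c1 -> red4 c3 = 2 ->
  ~ nf_rep 1 d 0 c1 0 c3 (test_form 2 8).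
Proof.
move=> pd pc1 /(@red4_half _ true) [g [-> pg]] [x1 [x2 [x3 [y1 [y2 [y3 [E P]]]]]]].
have S w w' : par (nf_scal 1 d 0 c1 0 (2 * g)
     (dot x1 w) (dot x2 w) (dot x3 w) (dot y1 w) (dot y2 w) (dot y3 w)
     (dot x1 w') (dot x2 w') (dot x3 w') (dot y1 w') (dot y2 w') (dot y3 w')) = false.
  by rewrite -nf_gram_eval -E test_form_eval !parS.
have Y2 w : even_at w y2.
  have := S w w; rewrite /even_at /nf_scal !parS pc1 pd /=.
  by case: (par (dot y2 w)); case: (par (dot x2 w)); case: (par (dot x1 w)); case: (par (dot y1 w)).
(* With y2 and d even, the products mod 2 reduce to x1 y1' + y1 x1', which therefore vanishes: x1
   and y1 are proportional mod 2. *)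
case: (@nf_hyperbolic_dichotomy x1 y1) => [w j hw pj|H|H].
- have := S w (delta_mx j 0); rewrite /nf_scal !parS pd hw (Y2 w) (Y2 (delta_mx j 0)).
  by rewrite /even_at (dot_delta x1) pj /= !andbF !andbT !addbF.
- exact: nf_2mod4_sub pd pc1 pg E P H.
- rewrite nf_gram_swap in E; apply: nf_2mod4_sub pd pc1 pg E _ H => w *; exact: P.
Qed.

(** Only even c is assumed, since division by 4 delivers T(a, c) for even c only. If d is odd, all
    three planes can be permuted to put an odd norm last; if d is even and c3 too, c1 may be taken
    odd, and c3 is 0 or 2 mod 4. *)
Lemma nf_base_obstruction d e c1 c3 : d != 0 -> par e || par c1 || par c3 ->
    (forall a c, a != 0 -> c != 0 -> par c = false ->
       nf_rep 1 d e c1 0 c3 (test_form a c)) -> False.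
Proof.
(* Residues mod 16 distinguish 1, 2, 4 and 8 from 0. *)
have n0 n : z2s n%:R 4 != 0 -> n%:R != 0 :> Z2.
  by apply: contra => /eqP ->; rewrite z2s0.
have [t1 t2 t8] : [/\ 1 != 0 :> Z2, 2 != 0 :> Z2 & 8 != 0 :> Z2].
  by split; [apply: (n0 1%N) | apply: (n0 2%N) | apply: (n0 8%N)]; rewrite z2s_nat.
have odd_case d' e' c1' c3' : d' != 0 -> par c3' ->
    nf_rep 1 d' e' c1' 0 c3' (test_form 1 (4 * d' * d')) -> False.
  move=> d0 p3; have or3 x : par x || par c3' by rewrite p3 orbT.
  move/(nf_clear_e_odd (or3 _))/nf_swap12/(nf_clear_e_odd (or3 _)).
  exact: nf_odd_obstruction.
move=> d0 po H.
have H4 d' : d' != 0 -> nf_rep 1 d e c1 0 c3 (test_form 1 (4 * d' * d')).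
  have t4 : 4 != 0 :> Z2 by apply: (n0 4%N); rewrite z2s_nat.
  by move=> d'0; apply: H; rewrite ?parS // !mulf_neq0.
case p3: (par c3); first exact: odd_case d0 p3 (H4 _ d0).
rewrite p3 orbF in po.
case pd: (par d).
  have R := nf_unit_d3 pd (H4 _ t1); case p1: (par c1).
    exact: (odd_case _ _ _ _ t1 p1 (nf_swap13 (nf_swap12 R))).
  by rewrite p1 orbF in po; apply: (odd_case _ _ _ _ t1 po (nf_swap13 R)).
wlog p1 : e c1 po H {H4} / par c1.
  case p1: (par c1); first by move/(_ _ _ po H p1).
  move=> h; have pe : par e by rewrite p1 orbF in po.
  apply: (h c1 e); [by rewrite pe orbT | | exact: pe].
  by move=> a c a0 c0 pc; apply: nf_swap12; apply: H.
have {}H a c : a != 0 -> c != 0 -> par c = false -> nf_rep 1 d 0 c1 0 c3 (test_form a c).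
  by move=> *; apply: (@nf_clear_e_odd _ _ e); rewrite ?p1 //; apply: H.
have /par_half [h hE] := p3; have r4 : red4 c3 = (2 * par h)%:R.
  by rewrite hE -[h in 2 * h]mulr1 red4_dbl par1 andbT.
case ph: (par h) in r4.
  by apply: (nf_2mod4_obstruction pd p1 r4); apply: H; rewrite ?par_nat.
by apply: (nf_even_obstruction pd p1 r4); apply: (H 1 2); rewrite ?par_nat.
Qed.

(** * Division of a representation by 4 *)

(** The first clause says that [c1 c2; c2 c3], of determinant 2 mod 4, has norm 0 mod 4 only at even
    vectors. The second supplies the hypothesis of [nf_hyperbolic_dichotomy]. *)
Lemma descent_table :
  all (fun n1 => all (fun n2 => all (fun n3 => det_mod4 n1 n2 n3 ==>
    all (fun u : bits => (norm4 0 n1 n2 n3 u %% 4 == 0)%N ==>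
      let: (x1, y1, y2, y3) := u in
      [&& ~~ x1 ==> ~~ y1 ==> ~~ y2 && ~~ y3 &
       all (fun v : bits => let: (x1', _, _, _) := v in
         [&& (norm4 0 n1 n2 n3 v %% 4 == 0)%N, ~~ scal2 0 n1 n2 n3 u v, ~~ x1 & x1']
           ==> ~~ y1) all_bits]) all_bits)
  (iota 0 4)) (iota 0 4)) (iota 0 4).
Proof. by vm_compute. Qed.

(** In the basis dual to x1, x2, x3, the rows y2 and y3 are even on the last two vectors; halving
    them there divides those Gram entries by 4 when d2 and d3 are halved. As x1 pairs with y1 with
    coefficient 1, a new y1 can be chosen to produce the first row of the Gram matrix. The unchanged
    x1, x2, x3 keep primitivity. *)
Lemma nf_descent_sub d2 d3 c1 c2 c3 a c x1 x2 x3 y1 y2 y3 :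
    par c = false ->
    4 *: test_form a c = nf_gram (2 * d2) (2 * d3) 0 c1 c2 c3 x1 x2 x3 y1 y2 y3 ->
    (forall w, even_at w x1 -> even_at w x2 -> even_at w x3 ->
               even_at w y1 -> even_at w y2 -> even_at w y3 -> evm w) ->
    (forall w, even_at w x1 -> even_at w y1) ->
    (forall w, even_at w x1 -> even_at w y2 /\ even_at w y3) ->
  nf_rep d2 d3 0 c1 c2 c3 (test_form a c).
Proof.
move=> /par_half [c' cE] E P H1 H23.
have [w h1 h2 h3|W uW WE] := @unit_rows x1 x2 x3.
  by have [h4 h5] := H23 _ h1; apply: P; auto.
pose G j k := ((col j W)^T *m test_form a c *m col k W) 0 0.
have S j k : 4 * G j k = nf_scal (2 * d2) (2 * d3) 0 c1 c2 c3
     (dot x1 (col j W)) (dot x2 (col j W)) (dot x3 (col j W))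
     (dot y1 (col j W)) (dot y2 (col j W)) (dot y3 (col j W))
     (dot x1 (col k W)) (dot x2 (col k W)) (dot x3 (col k W))
     (dot y1 (col k W)) (dot y2 (col k W)) (dot y3 (col k W)).
  by rewrite -nf_gram_eval -E /G -scalemxAr -scalemxAl [RHS]mxE.
have half j : j != i0 -> exists h2 h3, dot y2 (col j W) = 2 * h2 /\ dot y3 (col j W) = 2 * h3.
  move=> j0; have [a1 _ _] := WE j; rewrite (negPf j0) in a1.
  have [|/par_half [h2 h2E] /par_half [h3 h3E]] := H23 (col j W).
    by rewrite /even_at a1 par0.
  by exists h2, h3.
have [h21 [h31 [h21E h31E]]] := half i1 isT.
have [h22 [h32 [h22E h32E]]] := half i2 isT.
have Gsym j k : G j k = G k j.
  rewrite /G !test_form_eval.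
  move: (col j W i0 0) (col j W i1 0) (col j W i2 0) (col k W i0 0) (col k W i1 0) (col k W i2 0).
  by move=> *; rewrite /A2; ring.
(* The first diagonal entry must equal 2 x1 y1, hence the need for T(a, c) to be even. *)
have [g gE] : exists g, G i0 i0 = 2 * g.
  apply: par_half; rewrite /G test_form_eval cE /A2 !parS /= !addbF.
  by rewrite [par (col i0 W i1 0) && _]andbC addbb andbF.
have cancel4 (X Y : Z2) : 4 * X = 4 * Y -> X = Y.
  move=> XY; apply: (mulfI z2_two_neq0); apply: (mulfI z2_two_neq0).
  by rewrite !mulrA -natrM.
pose y1' : 'rV[Z2]_3 := \row_j nth 0 [:: g; G i0 i1; G i0 i2] j.
pose y2' : 'rV[Z2]_3 := \row_j nth 0 [:: 0; h21; h22] j.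
pose y3' : 'rV[Z2]_3 := \row_j nth 0 [:: 0; h31; h32] j.
have dW (y : 'rV[Z2]_3) j : dot (y *m invmx W) (col j W) = y 0 j.
  by rewrite /dot colE -mulmxA mulKmx // -colE mxE.
exists x1, x2, x3, (y1' *m invmx W), (y2' *m invmx W), (y3' *m invmx W); split; last first.
  by move=> w h1 h2 h3 _ _ _; have [h4 h5] := H23 _ h1; apply: P; auto.
have ext (A B : 'M[Z2]_3) : (forall j k, ((col j W)^T *m A *m col k W) 0 0 =
    ((col j W)^T *m B *m col k W) 0 0) -> A = B.
  move=> AB; apply: (can_inj (@mulKmx _ _ _ W^T _)); first by rewrite unitmx_tr.
  apply: (can_inj (mulmxK uW)); apply/matrixP => j k.
  have := AB j k; rewrite !colE trmx_mul trmx_delta -!mulmxA.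
  rewrite -!rowE !mulmxA -!colE.
  by rewrite !mxE.
apply: ext => j k; rewrite nf_gram_eval !dW -/(G j k).
have ordP (m : 'I_3) : [\/ m = i0, m = i1 | m = i2].
  by case: m => -[|[|[|//]]] ?; [constructor 1 | constructor 2 | constructor 3]; apply: val_inj.
have [a1 a2 a3] := WE i0; have [b1 b2 b3] := WE i1; have [d1 d2' d3'] := WE i2.
rewrite /= in a1 a2 a3 b1 b2 b3 d1 d2' d3'.
have Y j1 : [/\ y1' 0 j1 = nth 0 [:: g; G i0 i1; G i0 i2] j1, y2' 0 j1 = nth 0 [:: 0; h21; h22] j1 &
  y3' 0 j1 = nth 0 [:: 0; h31; h32] j1] by rewrite !mxE.
have [-> -> ->] := Y j; have [-> -> ->] := Y k; clear Y.
case: (ordP j) => ->; case: (ordP k) => ->;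
  rewrite /= ?(a1, a2, a3, b1, b2, b3, d1, d2', d3').
- by rewrite gE /nf_scal !(mul0r, mulr0, addr0, mul1r, mulr1); ring.
- by rewrite /nf_scal !(mul0r, mulr0, addr0, add0r, mul1r, mulr1).
- by rewrite /nf_scal !(mul0r, mulr0, addr0, add0r, mul1r, mulr1).
- by rewrite Gsym /nf_scal !(mul0r, mulr0, addr0, add0r, mul1r, mulr1).
- apply: cancel4; rewrite S b1 b2 b3 h21E h31E /nf_scal !(mul0r, mulr0, addr0, add0r, mul1r, mulr1).
  by ring.
- apply: cancel4; rewrite S b1 b2 b3 d1 d2' d3' h21E h31E h22E h32E.
  by rewrite /nf_scal !(mul0r, mulr0, addr0, add0r, mul1r, mulr1); ring.
- by rewrite Gsym /nf_scal !(mul0r, mulr0, addr0, add0r, mul1r, mulr1).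
- apply: cancel4; rewrite S b1 b2 b3 d1 d2' d3' h21E h31E h22E h32E.
  by rewrite /nf_scal !(mul0r, mulr0, addr0, add0r, mul1r, mulr1); ring.
apply: cancel4; rewrite S d1 d2' d3' h22E h32E /nf_scal.
by rewrite !(mul0r, mulr0, addr0, add0r, mul1r, mulr1); ring.
Qed.

Lemma nf_descent d2 d3 c1 c2 c3 a c : par c = false -> red4 (c1 * c3 - c2 * c2) = 2 ->
  nf_rep (2 * d2) (2 * d3) 0 c1 c2 c3 (4 *: test_form a c) ->
  nf_rep d2 d3 0 c1 c2 c3 (test_form a c).
Proof.
move=> pc D [x1 [x2 [x3 [y1 [y2 [y3 [E P]]]]]]].
have [n1 l1 [h1 p1]] := red4P c1; have [n2 l2 [h2 p2]] := red4P c2.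
have [n3 l3 [h3 p3]] := red4P c3.
have det : det_mod4 n1 n2 n3.
  rewrite -[det_mod4 _ _ _]/(n1 * n3 + 3 * (n2 * n2) == 2 %[mod 4])%N.
  rewrite -red4_nat_eq natrD !natrM -h1 -h2 -h3 -D rmorphB !rmorphM /=.
  have -> : 3 = 4 - 1 :> 'Z_4 by ring.
  by rewrite Z4_four; apply/eqP; ring.
have iotaP n : (n < 4)%N -> n \in iota 0 4 by rewrite mem_iota.
have /allP/(_ n2 (iotaP _ l2)) := allP descent_table n1 (iotaP _ l1).
move/allP/(_ n3 (iotaP _ l3)); rewrite det implyTb => /allP tab.
have S w w' : 4 * (w^T *m test_form a c *m w') 0 0 = nf_scal (2 * d2) (2 * d3) 0 c1 c2 c3
     (dot x1 w) (dot x2 w) (dot x3 w) (dot y1 w) (dot y2 w) (dot y3 w)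
     (dot x1 w') (dot x2 w') (dot x3 w') (dot y1 w') (dot y2 w') (dot y3 w').
  by rewrite -nf_gram_eval -E -scalemxAr -scalemxAl [RHS]mxE.
pose b w : bits := (par (dot x1 w), par (dot y1 w), par (dot y2 w), par (dot y3 w)).
have N0 w : (norm4 0 n1 n2 n3 (b w) %% 4 == 0)%N.
  have z0 : red4 0 = 0%:R by rewrite rmorph0.
  have := S w w => /(congr1 red4); rewrite red4_four.
  rewrite (nf_scal_mod4 _ _ _ _ _ _ (par_dbl _) (par_dbl _) z0 h1 h2 h3).
  by move=> /esym/eqP; rewrite -[0]/(0%:R) red4_nat_eq.
have S0 w w' : ~~ scal2 0 n1 n2 n3 (b w) (b w').
  have /(congr1 par) := S w w'.
  by rewrite (@nf_scal_mod2 _ _ _ _ _ _ _ _ _ _ _ _ _ _ _ _ _ _ 0 _ _ _ (par_dbl _) (par_dbl _) par0 p1 p2 p3)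
     parM par_nat => /esym/negbT.
have K1 w : even_at w x1 -> even_at w y1 -> even_at w y2 /\ even_at w y3.
  rewrite /even_at => e1 e2; have := tab (b w) (all_bitsP _); rewrite N0 /= e1 e2 /=.
  by move=> /andP[/andP[/negbTE -> /negbTE ->]].
case: (@nf_hyperbolic_dichotomy x1 y1) => [w j e1 pj|H|H].
- have := tab (b w) (all_bitsP _); rewrite N0 implyTb => /andP[_ /allP tabw].
  have := tabw (b (delta_mx j 0)) (all_bitsP _).
  have := N0 (delta_mx j 0); have := S0 w (delta_mx j 0); rewrite /b => -> ->.
  by rewrite e1 dot_delta pj /= => /negbTE.
- by apply: (nf_descent_sub pc E P H) => w e1; apply: K1 => //; apply: H.
rewrite nf_gram_swap in E; apply: (nf_descent_sub pc E _ H) => w *; first exact: P.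
by apply: K1 => //; apply: H.
Qed.

Lemma test_formZ k a c : k *: test_form a c = test_form (k * a) (k * c).
Proof.
apply/matrixP => i j; rewrite !mxE; case: i => -[|[|[|//]]] ?;
by case: j => -[|[|[|//]]] ? /=; rewrite ?mulr0 // mulrCA.
Qed.

Lemma z2_four_neq0 : 4 != 0 :> Z2.
Proof. by rewrite -[4]/((2 * 2)%:R) natrM mulf_neq0 // z2_two_neq0. Qed.

Lemma nf_descent_iter b d3 c1 c2 c3 a c :
  par c = false -> red4 (c1 * c3 - c2 * c2) = 2 ->
  nf_rep (2 ^+ b) (2 ^+ b * d3) 0 c1 c2 c3 (4 ^+ b *: test_form a c) ->
  nf_rep 1 d3 0 c1 c2 c3 (test_form a c).
Proof.
move=> pc D; elim: b a c pc => [|b IH] a c pc; first by rewrite !expr0 mul1r scale1r.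
rewrite ![_ ^+ b.+1]exprS -mulrA -scalerA test_formZ => h.
have pc' : par (4 ^+ b * c) = false by rewrite parM pc andbF.
have := nf_descent pc' D h; rewrite -test_formZ; exact: IH.
Qed.

Lemma nf_obstruction b d3 e c1 c2 c3 : d3 != 0 ->
  (forall a c, a != 0 -> c != 0 ->
     nf_rep (2 ^+ b) (2 ^+ b * d3) e c1 c2 c3 (test_form a c)) -> False.
Proof.
move=> d0 H; case: b H => [|b] H.
  rewrite !expr0 mul1r in H.
  case po: (par e || par c1 || par c3).
    by apply: (nf_base_obstruction d0 po) => *; apply: nf_clear_c2; apply: H.
  move/negbT: po; rewrite !negb_or => /andP[/andP[/negbTE pe /negbTE p1] /negbTE p3].
  apply: (nf_even_form_obstruction pe p1 p3); apply: nf_clear_c2.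
  by apply: H; apply: oner_neq0.
have pb k : par (2 ^+ b.+1 * k) = false by rewrite exprS -mulrA par_dbl.
have D : red4 (c1 * c3 - c2 * c2) = 2.
  have pb1 := pb 1; rewrite mulr1 in pb1; apply: (nf_mod4_obstruction pb1 (pb d3)).
  by move=> c c0; apply: H => //; apply: oner_neq0.
(* If c1 and c3 were even, so would be c2, and the determinant would be 0 mod 4. *)
have p13 : par c1 || par c3.
  have [y [dE py]] := @red4_half _ true D.
  apply: contrapT => /negP; rewrite negb_or => /andP[/negbTE + /negbTE].
  move=> /par_half [s sE] /par_half [t tE]; rewrite sE tE in dE.
  have /par_half [r rE] : par c2 = false.
    by move/(congr1 par): dE; rewrite !parS /=; case: (par c2).
  have : y = 2 * (s * t - r * r).
    by apply: (mulfI z2_two_neq0); rewrite -dE rE; ring.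
  by move/(congr1 par); rewrite py par_dbl.
apply: (@nf_base_obstruction d3 0 c1 c3 d0); first by rewrite par0 p13.
move=> a c a0 c0 pc; apply: nf_clear_c2; apply: (@nf_descent_iter b.+1 d3 c1 c2 c3 a c pc D).
rewrite test_formZ; apply: (nf_clear_e_odd p13); apply: H.
  by rewrite mulf_neq0 // expf_neq0 // z2_four_neq0.
by rewrite mulf_neq0 // expf_neq0 // z2_four_neq0.
Qed.

(** * Splitting along a totally isotropic sublattice *)

(** Compactness by König's lemma: a residue mod 2^k taken infinitely often ([inf]) has one of its
    two lifts mod 2^(k+1) taken infinitely often, and a branch [rs] of this tree is the limit. *)
Lemma z2_subseq (x : nat -> Z2) :
  exists (f : nat -> nat) (l : Z2), forall k, (k <= f k)%N /\ z2s (x (f k)) k = z2s l k.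
Proof.
pose inf k r := forall N, exists m, (N <= m)%N /\ z2s (x m) k = r.
have step k r : inf k r -> exists r', r = modz r' (pw k) /\ inf k.+1 r'.
  move=> h; have [m0 [_ r_mod]] := h 0%N; have rE := z2_red (x m0) k.
  rewrite r_mod in rE.
  have [i0|/existsNP [N1 n1]] := pselect (inf k.+1 r); first by exists r; split; rewrite ?rE.
  have [i1|/existsNP [N2 n2]] := pselect (inf k.+1 (r + pw k)).
    by exists (r + pw k); split; rewrite ?modzDr ?rE.
  have [m [mN mr]] := h (maxn N1 N2); move: mN; rewrite geq_max => /andP[m1 m2].
  have [E|E] : z2s (x m) k.+1 = r \/ z2s (x m) k.+1 = r + pw k.
  - have := z2s_lt (x m) k.+1; have := z2s_ge0 (x m) k.+1; rewrite pwS.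
    rewrite (z2P (x m) k) in mr; rewrite (divz_eq (z2s (x m) k.+1) (pw k)) mr.
    have := modz_ge0 (z2s (x m) k.+1) (pw_neq0 k).
    have := ltz_pmod (z2s (x m) k.+1) (pw_gt0 k); rewrite mr.
    have := pw_gt0 k; move: (pw k) (_ %/ _)%Z => p q p0 rp r0 qp0 qp.
    have [q0|[q1|[qn|qb]]] : q = 0 \/ q = 1 \/ q <= -1 \/ 2 <= q by lia.
    + by left; rewrite q0; lia.
    + by right; rewrite q1; lia.
    + have : q * p <= -1 * p by rewrite ler_wpM2r // ltW.
      lia.
    have : 2 * p <= q * p by rewrite ler_wpM2r // ltW.
    lia.
  - by case: n1; exists m.
  by case: n2; exists m.
pose next k r := if pselect (exists r', r = modz r' (pw k) /\ inf k.+1 r') is left h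
  then projT1 (cid h) else 0.
pose rs := fix rs k := if k is k'.+1 then next k' (rs k') else 0.
have inf0 : inf 0%N 0.
  by move=> N; exists N; split => //; rewrite -[LHS]z2_red modz1.
have infS k : inf k (rs k) -> rs k = modz (rs k.+1) (pw k) /\ inf k.+1 (rs k.+1).
  move=> h; rewrite /= /next; case: pselect => [h'|]; first by case: (cid h').
  by case; apply: step.
have infA k : inf k (rs k) by elim: k => // k /infS [].
have H k : rs k = modz (rs k.+1) (pw k) by have [] := infS k (infA k).
have ch k : exists m, (k <= m)%N /\ z2s (x m) k = rs k by apply: infA.
exists (fun k => projT1 (cid (ch k))), (MkZ2 H) => k.
by case: (cid (ch k)).
Qed.

Lemma z2_subseq_family (I : eqType) (s : seq I) (x : I -> nat -> Z2) :
  exists (f : nat -> nat) (l : I -> Z2), forall k,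
    (k <= f k)%N /\ forall i, i \in s -> z2s (x i (f k)) k = z2s (l i) k.
Proof.
elim: s => [|i0 s [f [l fl]]]; first by exists id, (fun=> 0).
have [g [l0 gl]] := z2_subseq (x i0 \o f).
exists (f \o g), (fun i => if i == i0 then l0 else l i) => k.
have [gk gk'] := gl k; have [fk fk'] := fl (g k).
split; first exact: leq_trans gk fk.
move=> i; rewrite inE; case: eqP => [-> _|_ /= si]; first exact: gk'.
by rewrite (z2s_mod _ gk) fk' // -z2s_mod.
Qed.

Lemma mx_subseq m n (X : nat -> 'M[Z2]_(m, n)) :
  exists (f : nat -> nat) (L : 'M[Z2]_(m, n)), forall k,
    (k <= f k)%N /\ exists T, X (f k) = L + 2 ^+ k *: T.
Proof.
have [f [l fl]] := z2_subseq_family (enum {: 'I_m * 'I_n}) (fun p k => X k p.1 p.2).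
exists f, (\matrix_(i, j) l (i, j)) => k; have [fk h] := fl k; split => //.
have t i j : exists t, X (f k) i j = l (i, j) + 2 ^+ k * t.
  have [|t tE] := @z2s_eq0P (X (f k) i j - l (i, j)) k _.
    by rewrite /= (h (i, j)) ?mem_enum // modzDmr subrr mod0z.
  by exists t; rewrite -tE addrC subrK.
exists (\matrix_(i, j) projT1 (cid (t i j))); apply/matrixP => i j.
by rewrite !mxE; case: (cid (t i j)).
Qed.

Definition representable n (G : 'M[Z2]_n) (A : 'M[Z2]_3) : Prop :=
  exists2 X : 'M[Z2]_(n, 3), X^T *m G *m X = A & primitive X.

(** A limit L of primitive representations of T(2^k, 2^k) has its Gram matrix divisible by every
    power of 2. It is primitive because it agrees mod 2 with one of them. *)
Lemma isotropic_limit n (G : 'M[Z2]_n) :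
    (forall a c, a != 0 -> c != 0 -> representable G (test_form a c)) ->
  exists2 E : 'M[Z2]_(n, 3), E^T *m G *m E = 0 & primitive E.
Proof.
move=> H; have p0 k : 2 ^+ k != 0 :> Z2 by rewrite expf_neq0 // z2_two_neq0.
pose X k := s2val (cid2 (H _ _ (p0 k) (p0 k))).
have XE k : (X k)^T *m G *m X k = test_form (2 ^+ k) (2 ^+ k).
  by rewrite /X; case: (cid2 _).
have XP k : primitive (X k) by rewrite /X; case: (cid2 _).
have [f [L fL]] := mx_subseq X; exists L; last first.
  have [_ [T TE]] := fL 1%N; move=> w Lw; apply: (XP (f 1%N)); rewrite TE expr1.
  rewrite /evm mulmxDl map_mxD Lw add0r -scalemxAl.
  by apply/evmP => i j; rewrite mxE par_dbl.
apply/matrixP => i j; rewrite [RHS]mxE; apply: z2_sep => k.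
have [kf [T TE]] := fL k; pose B := test_form (2 ^+ (f k - k)) (2 ^+ (f k - k)).
have LE : L = X (f k) - 2 ^+ k *: T by rewrite TE addrK.
have BE : (X (f k))^T *m G *m X (f k) = 2 ^+ k *: B.
  by rewrite XE test_formZ -exprD subnKC.
exists ((B - (X (f k))^T *m G *m T - T^T *m G *m X (f k) + 2 ^+ k *: (T^T *m G *m T)) i j).
have -> : L^T *m G *m L = 2 ^+ k *: (B - (X (f k))^T *m G *m T - T^T *m G *m X (f k)
             + 2 ^+ k *: (T^T *m G *m T)).
  have LT : L^T = (X (f k))^T - 2 ^+ k *: T^T.
    by rewrite LE; apply/matrixP => a b; rewrite !mxE.
  rewrite LT LE mulmxBl mulmxBl !mulmxBr BE -!scalemxAl -!scalemxAr.
  apply/matrixP => a b; rewrite !mxE; move: (B a b) (\sum_(_ < _) _) (\sum_(_ < _) _) (\sum_(_ < _) _).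
  by move: (2 ^+ k) => *; ring.
by rewrite mxE.
Qed.

(** Primitive representation by the lattice with Gram matrix [0 D; D^T C], where X and Y are the
    coordinates along the isotropic half and its complement. *)
Definition split_rep (D C A : 'M[Z2]_3) : Prop :=
  exists X Y : 'M[Z2]_3, X^T *m D *m Y + Y^T *m D^T *m X + Y^T *m C *m Y = A /\
    forall w : 'cV_3, evm (X *m w) -> evm (Y *m w) -> evm w.

Lemma split_rep_basis D C A U V : U \in unitmx -> V \in unitmx ->
  split_rep D C A -> split_rep (U *m D *m V) (V^T *m C *m V) A.
Proof.
move=> uU uV [X [Y [E P]]]; have uU' : U^T \in unitmx by rewrite unitmx_tr.
pose X' := invmx U^T *m X; pose Y' := invmx V *m Y.
have XE : X = U^T *m X' by rewrite mulKVmx.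
have YE : Y = V *m Y' by rewrite mulKVmx.
exists X', Y'; split.
  rewrite -E XE YE; move: X' Y' {XE YE E} => X' Y'.
  by rewrite !trmx_mul trmxK !mulmxA.
by move=> w h1 h2; apply: P; rewrite ?XE ?YE -mulmxA; apply: evm_mul.
Qed.

Lemma gram_split (R : comNzRingType) m n p q (G : 'M[R]_m) (E : 'M[R]_(m, n))
    (F : 'M[R]_(m, p)) (X : 'M[R]_(n, q)) (Y : 'M[R]_(p, q)) :
    G^T = G -> E^T *m G *m E = 0 ->
  (E *m X + F *m Y)^T *m G *m (E *m X + F *m Y) =
  X^T *m (E^T *m G *m F) *m Y + Y^T *m (E^T *m G *m F)^T *m X
  + Y^T *m (F^T *m G *m F) *m Y.
Proof.
move=> Gs EE.
have -> : (E *m X + F *m Y)^T = X^T *m E^T + Y^T *m F^T.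
  by rewrite -!trmx_mul; apply: linearD.
rewrite !trmx_mul trmxK Gs !mulmxDl !mulmxDr !mulmxA.
have -> : X^T *m E^T *m G *m E *m X = 0.
  by rewrite -!mulmxA [G *m (E *m X)]mulmxA [E^T *m _]mulmxA [E^T *m _]mulmxA EE mul0mx mulmx0.
by rewrite add0r addrA.
Qed.

Lemma lattice_split (G : 'M[Z2]_(3 + 3)) : is_lattice G ->
    (forall a c, a != 0 -> c != 0 -> representable G (test_form a c)) ->
  exists D C : 'M[Z2]_3, [/\ C^T = C, forall v : 'cV_3, D^T *m v = 0 -> v = 0 &
    forall a c, a != 0 -> c != 0 -> split_rep D C (test_form a c)].
Proof.
move=> [Gs Gn] H; have [E EE EP] := isotropic_limit H.
have [F uP] := primitive_basis EP; set P := row_mx E F in uP.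
exists (E^T *m G *m F), (F^T *m G *m F); split.
- by rewrite !trmx_mul trmxK Gs mulmxA.
(* If D^T v = 0, then E v is orthogonal to both E and F, hence zero by nondegeneracy. *)
- move=> v; rewrite !trmx_mul trmxK Gs => Dv.
  have PGE : P^T *m (G *m (E *m v)) = 0.
    rewrite tr_row_mx mul_col_mx !mulmxA EE mul0mx -!mulmxA.
    by move: Dv; rewrite -!mulmxA => ->; rewrite col_mx0.
  have uPT : P^T \in unitmx by rewrite unitmx_tr.
  have Ev0 : E *m v = 0.
    by apply: Gn; rewrite -[LHS](mulKmx uPT) PGE mulmx0.
  have : P *m col_mx v 0 = 0 by rewrite mul_row_col Ev0 mulmx0 addr0.
  move/(congr1 (mulmx (invmx P))); rewrite mulKmx // mulmx0.
  by move/(congr1 usubmx); rewrite col_mxKu linear0.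
move=> a c a0 c0; have [Z ZE ZP] := H a c a0 c0.
pose W := invmx P *m Z; exists (usubmx W), (dsubmx W).
have ZW : Z = E *m usubmx W + F *m dsubmx W.
  by rewrite -mul_row_col vsubmxK mulKVmx.
split; last first.
  by move=> w h1 h2; apply: ZP; rewrite ZW mulmxDl /evm map_mxD -!mulmxA
     (evm_mul E h1) (evm_mul F h2) addr0.
rewrite -ZE [in RHS]ZW.
by rewrite (gram_split _ _ _ Gs EE).
Qed.

(** * Smith normal form over Z_2 *)

Lemma tperm_unit_entry n (D : 'M[Z2]_(1 + n)) i j :
  exists U V, [/\ U \in unitmx, V \in unitmx & (U *m D *m V) 0 0 = D i j].
Proof.
exists (tperm_mx 0 i), (tperm_mx 0 j).
by rewrite !unitmx_perm -xrowE -xcolE !mxE !tpermL.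
Qed.

Lemma unit_block n (D : 'M[Z2]_(1 + n)) : (exists i j, par (D i j)) ->
  exists U V D', [/\ U \in unitmx, V \in unitmx & U *m D *m V = block_mx 1%:M 0 0 D'].
Proof.
case=> i [j pij]; have [U [V [uU uV E]]] := tperm_unit_entry D i j.
have [a aD] := par_inv_ex pij.
have [M MD {}E] : exists2 M, M = U *m D *m V & M 0 0 = D i j by exists (U *m D *m V).
have ME := submxK M.
have ulE : ulsubmx M = (D i j)%:M.
  rewrite [LHS]mx11_scalar !mxE -E; congr (_%:M).
  by congr (M _ _); apply: val_inj.
pose L : 'M[Z2]_(1 + n) := block_mx 1%:M 0 (- a *: dlsubmx M) 1%:M.
pose R : 'M[Z2]_(1 + n) := block_mx a%:M (- a *: ursubmx M) 0 1%:M.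
exists (L *m U), (V *m R), (- a *: dlsubmx M *m ursubmx M + drsubmx M); split.
- by rewrite unitmx_mul uU andbT unitmxE det_lblock !det1 mulr1 unitr1.
- rewrite unitmx_mul uV unitmxE det_ublock det1 mulr1 det_scalar1.
  exact: (z2unitPl (etrans (mulrC _ _) aD)).
have -> : L *m U *m D *m (V *m R) = L *m M *m R by rewrite MD !mulmxA.
have Z : - a *: dlsubmx M *m (D i j)%:M + dlsubmx M = 0.
  by rewrite mul_mx_scalar scalerA mulrN [_ * a]mulrC aD scaleN1r addNr.
rewrite -[in LHS]ME ulE mulmx_block !mul1mx !mul0mx !addr0 Z mulmx_block.
rewrite !mulmx0 !mulmx1 !mul0mx !addr0 add0r.
congr block_mx; first by rewrite -scalar_mxM mulrC aD.
by rewrite mul_scalar_mx scalerA mulrN [_ * a]mulrC aD scaleN1r addNr.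
Qed.

Lemma mx_valuation m n (D : 'M[Z2]_(m, n)) : D != 0 ->
  exists b D', D = 2 ^+ b *: D' /\ exists i j, par (D' i j).
Proof.
move=> D0; have [i [j /z2_valuation [k [u [Du pu]]]]] : exists i j, D i j != 0.
  apply: contrapT => h; case/eqP: D0; apply/matrixP => i j; rewrite mxE.
  by apply/eqP; apply: contrapT => /negP h'; apply: h; exists i, j.
elim: k D {D0} Du => [|k IH] D Du.
  by exists 0%N, D; rewrite scale1r; split => //; exists i, j; rewrite Du mul1r.
have [h|n0] := pselect (exists i j, par (D i j)).
  by exists 0%N, D; rewrite scale1r.
have t a b : exists y, D a b = 2 * y.
  by apply: par_half; apply/negbTE/negP => p; apply: n0; exists a, b.
pose D2 := \matrix_(a, b) projT1 (cid (t a b)).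
have D2E : D = 2 *: D2.
  by apply/matrixP => a b; rewrite !mxE; case: (cid _).
have [|c [D' [E P]]] := IH D2.
  by move: Du; rewrite D2E [LHS]mxE exprS -mulrA => /(mulfI z2_two_neq0).
by exists c.+1, D'; split => //; rewrite D2E E scalerA exprS.
Qed.

Lemma smith_normal_form n (D : 'M[Z2]_n) : exists U V (d : 'rV[Z2]_n),
  [/\ U \in unitmx, V \in unitmx, U *m D *m V = diag_mx d,
      forall i, d 0 i = 0 \/ exists b, d 0 i = 2 ^+ b &
      forall i j : 'I_n, (i <= j)%N -> exists q, d 0 j = d 0 i * q].
Proof.
elim: n D => [|n IH] D.
  by exists 1%:M, 1%:M, 0; split; rewrite ?unitmx1 //; [apply/matrixP => [[]] | case | case].
have [->|D0] := eqVneq D 0.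
  exists 1%:M, 1%:M, 0; split; rewrite ?unitmx1 ?mulmx0 ?mul0mx ?linear0 //.
    by move=> i; left; rewrite mxE.
  by move=> i j _; exists 0; rewrite !mxE mulr0.
have [b [D1 [DE h]]] := mx_valuation D0.
have [U1 [V1 [D2 [uU1 uV1 E1]]]] := @unit_block n D1 h.
have [U2 [V2 [d [uU2 uV2 E2 d1 d2]]]] := IH D2.
pose B (M : 'M[Z2]_n) : 'M[Z2]_(1 + n) := block_mx 1%:M 0 0 M.
have uB M : M \in unitmx -> B M \in unitmx.
  by rewrite !unitmxE det_lblock det1 mul1r.
exists (B U2 *m U1), (V1 *m B V2), (2 ^+ b *: row_mx 1%:M d); split.
- by rewrite unitmx_mul uU1 uB.
- by rewrite unitmx_mul uV1 uB.
- have -> : B U2 *m U1 *m D *m (V1 *m B V2) = 2 ^+ b *: (B U2 *m (U1 *m D1 *m V1) *m B V2).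
    by rewrite DE -!scalemxAr -!scalemxAl !mulmxA.
  rewrite E1 !mulmx_block !(mul1mx, mulmx1, mul0mx, mulmx0, addr0, add0r) E2.
  have -> (v : 'rV[Z2]_(1 + n)) : diag_mx (2 ^+ b *: v) = 2 ^+ b *: diag_mx v.
    exact: linearZ.
  rewrite diag_mx_row (_ : diag_mx 1%:M = 1%:M :> 'M[Z2]_1) //.
  by apply/matrixP => i j; rewrite !mxE !ord1.
- move=> i; rewrite mxE; case: (@split_ordP 1 n i) => k ->.
    by right; exists b; rewrite row_mxEl mxE ord1 mulr1.
  rewrite row_mxEr; case: (d1 k) => [->|[c ->]]; first by left; rewrite mulr0.
  by right; exists (b + c)%N; rewrite exprD.
move=> i j; rewrite [X in exists q, X = _]mxE.
have -> : (2 ^+ b *: row_mx 1%:M d : 'rV_n.+1) 0 i = 2 ^+ b * (row_mx 1%:M d : 'rV_(1 + n)) 0 i.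
  by rewrite mxE.
case: (@split_ordP 1 n i) => k ->; case: (@split_ordP 1 n j) => l -> /=.
- by exists 1; rewrite !row_mxEl !ord1 mulr1.
- by exists (d 0 l); rewrite row_mxEl row_mxEr mxE ord1 mulr1.
- by rewrite (ord1 l).
rewrite leq_add2l => /d2 [q qE]; exists q.
by rewrite !row_mxEr qE mulrA.
Qed.

(** * The case where D is divisible by 2 *)

Lemma evm_half m n (M : 'M[Z2]_(m, n)) : evm M -> exists N, M = 2 *: N.
Proof.
move=> /evmP ev; have t a b : exists y, M a b = 2 * y by apply: par_half.
exists (\matrix_(a, b) projT1 (cid (t a b))).
by apply/matrixP => a b; rewrite !mxE; case: (cid _).
Qed.

Lemma evm_dbl m n (M : 'M[Z2]_(m, n)) : evm (2 *: M).
Proof. by apply/evmP => i j; rewrite mxE par_dbl. Qed.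

Lemma evmD m n (A B : 'M[Z2]_(m, n)) : evm A -> evm B -> evm (A + B).
Proof. by rewrite /evm map_mxD => -> ->; rewrite addr0. Qed.

Lemma congr_entry (R : comNzRingType) n m (A : 'M[R]_n) (W : 'M[R]_(n, m)) j k :
  (W^T *m A *m W) j k = ((col j W)^T *m A *m col k W) 0 0.
Proof.
rewrite !mxE; apply: eq_bigr => l _; rewrite !mxE; congr (_ * _).
by apply: eq_bigr => l' _; rewrite !mxE.
Qed.

(** The first two columns of Y have even last entries and A2-parts independent mod 2. Orthogonality
    mod 2 then makes the A2-part of the third column even and its last entry odd, so its norm is 1
    mod 4 and not 3. *)
Lemma test_form_mod4 (Y M : 'M[Z2]_3) :
  test_form 1 3 <> Y^T *m test_form 1 1 *m Y + 2 *: (M + M^T).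
Proof.
move=> /matrixP E.
have e i j : test_form 1 3 i j = A2 (Y i0 i) (Y i1 i) (Y i0 j) (Y i1 j)
    + Y i2 i * Y i2 j + 2 * (M i j + M j i).
  by rewrite E mxE congr_entry test_form_eval !mxE !mul1r.
move: (e i0 i0) (e i1 i1) (e i2 i2) (e i0 i1) (e i0 i2) (e i1 i2).
rewrite !test_formE mulr1.
move: (Y i0 i0) (Y i1 i0) (Y i2 i0) (Y i0 i1) (Y i1 i1) (Y i2 i1) (Y i0 i2) (Y i1 i2) (Y i2 i2).
move: (M i0 i0) (M i1 i1) (M i2 i2) (M i0 i1 + _) (M i0 i2 + _) (M i1 i2 + _).
move=> m0 m1 m2 m01 m02 m12 p q r p' q' r' p'' q'' r'' {e E Y M}.
have nrm (a b c m : Z2) : 2 = A2 a b a b + c * c + 2 * (m + m) ->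
    par c = false /\ par (a * a + a * b + b * b).
  move=> F; have pc : par c = false.
    by move/(congr1 par): F; rewrite /A2 !parS /=; case: (par c); case: (par a); case: (par b).
  split=> //; have /par_half [t tE] := pc.
  have : 1 = a * a + a * b + b * b + 2 * (t * t + m).
    by apply: (mulfI z2_two_neq0); rewrite mulr1 [LHS]F tE /A2; ring.
  by move/(congr1 par); rewrite par1 parD par_dbl addbF.
move=> /nrm [pr n0] /nrm [pr' n1] F2 /(congr1 par) F01 /(congr1 par) F02 /(congr1 par) F12.
have [pp [pq pr2]] : par p'' = false /\ par q'' = false /\ par r''.
  move: n0 n1 F01 F02 F12; move/(congr1 par): F2; rewrite /A2 !parS pr pr' /=.
  case: (par r''); case: (par p''); case: (par q'') => //=;
  by case: (par p); case: (par q); case: (par p'); case: (par q').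
move: F2; have -> : A2 p'' q'' p'' q'' + r'' * r'' + 2 * (m2 + m2) =
    2 * (p'' * (p'' + q'')) + 2 * (q'' * q'') + r'' * r'' + 4 * m2 by rewrite /A2; ring.
move/(congr1 red4); rewrite [RHS]rmorphD /= red4_four addr0 [RHS]rmorphD /=.
rewrite [X in _ = X + _]rmorphD /= !red4_dbl red4_sq pp pq pr2 /= rmorph_nat !add0r.
by move/eqP; rewrite red4_nat_eq.
Qed.

Lemma test_form_primitive : primitive (test_form 1 1).
Proof.
move=> w /evmP h; apply/evmP => i j; rewrite ord1.
have := (h i0 0, h i1 0, h i2 0); rewrite ![(_ *m _) _ _]mxE !sum3 !test_formE !parS /=.
rewrite !addbF => -[[h1 h0] h2].
by case: i => -[|[|[|//]]] lti; [rewrite -h0|rewrite -h1|rewrite -h2]; congr (par (w _ _)); apply: val_inj.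
Qed.

(** The terms in D contribute 2 (S + S^T). As T(1, 1) is nonsingular mod 2, representing it makes Y
    invertible; in the basis Y, the form C is T(1, 1) up to such terms, and T(1, 3) contradicts
    [test_form_mod4]. *)
Lemma split_even_obstruction D C :
  (forall c, c != 0 -> split_rep (2 *: D) C (test_form 1 c)) -> False.
Proof.
move=> H; have gramE (D' C' X Y : 'M[Z2]_3) :
    X^T *m (2 *: D') *m Y + Y^T *m (2 *: D')^T *m X + Y^T *m C' *m Y =
    2 *: (X^T *m D' *m Y + (X^T *m D' *m Y)^T) + Y^T *m C' *m Y.
  have -> : (2 *: D')^T = 2 *: D'^T by apply: linearZ.
  by rewrite !trmx_mul trmxK !mulmxA scalerDr -!scalemxAr -!scalemxAl.
have [|X [Y [E P]]] := H 1; first exact: oner_neq0.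
rewrite gramE in E.
have uY : Y \in unitmx.
  apply: primitive_unitmx => w Yw; apply: test_form_primitive.
  rewrite -E mulmxDl -scalemxAl -[Y^T *m C *m Y *m w]mulmxA.
  by apply: evmD; [apply: evm_dbl | apply: evm_mul].
have [|X' [Y' [E' _]]] := split_rep_basis (unitmx1 _ 3) uY (H 3 _).
  by apply/eqP => /(congr1 par); rewrite par_nat par0.
rewrite mul1mx -scalemxAl gramE in E'.
set S := X^T *m D *m Y in E; set S' := X'^T *m _ *m Y' in E'.
apply: (@test_form_mod4 Y' (S' - Y'^T *m S *m Y')).
rewrite -E' -E; clear E E'; clearbody S S'; move: (Y^T *m C *m Y) => N; set R := Y'^T *m S *m Y'.
have -> : Y'^T *m (2 *: (S + S^T) + N) *m Y' = 2 *: (R + R^T) + Y'^T *m N *m Y'.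
  rewrite mulmxDr mulmxDl -scalemxAr -scalemxAl mulmxDr mulmxDl.
  by congr (2 *: (_ + _) + _); rewrite !trmx_mul trmxK mulmxA.
move: R (Y'^T *m N *m Y') S' => R Z S'; apply/matrixP => i j; rewrite !mxE.
by move: (S' i j) (S' j i) (R i j) (R j i) (Z i j) => *; ring.
Qed.

(** As (e1, f1) = 1, subtracting suitable multiples of e1 from f2 and f3 makes them orthogonal to f1
    without changing their mutual products. *)
Lemma diag_split_nf (d : 'rV[Z2]_3) (C A : 'M[Z2]_3) : C^T = C -> d 0 i0 = 1 -> split_rep (diag_mx d) C A ->
  nf_rep (d 0 i1) (d 0 i2) (C i0 i0) (C i1 i1) (C i1 i2) (C i2 i2) A.
Proof.
move=> Cs d0 [X [Y [E P]]].
exists (row i0 X + C i0 i1 *: row i1 Y + C i0 i2 *: row i2 Y), (row i1 X), (row i2 X),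
  (row i0 Y), (row i1 Y), (row i2 Y); split.
  have sym i j : C i j = C j i by rewrite -{1}Cs mxE.
  apply/matrixP => i j; rewrite nf_gramE -E !row_entryE ![row _ _ _ _]mxE.
  rewrite tr_diag_mx !mul_mx_diag [LHS]mxE [in X in X + _]mxE.
  have e3 (M N : 'M[Z2]_3) : (M *m N) i j = M i i0 * N i0 j + M i i1 * N i1 j + M i i2 * N i2 j.
    by rewrite mxE sum3.
  rewrite !e3 ![(\matrix_(_, _) _) _ _]mxE !d0 !mulr1.
  have e4 k : (Y^T *m C) i k = Y i0 i * C i0 k + Y i1 i * C i1 k + Y i2 i * C i2 k.
    by rewrite mxE sum3 ![Y^T _ _]mxE.
  rewrite !e4 ![_^T _ _]mxE (sym i1 i0) (sym i2 i0) (sym i2 i1).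
  move: (X i0 i) (X i1 i) (X i2 i) (Y i0 i) (Y i1 i) (Y i2 i) (X i0 j) (X i1 j) (X i2 j)
        (Y i0 j) (Y i1 j) (Y i2 j) (d 0 i1) (d 0 i2) (C i0 i0) (C i0 i1) (C i0 i2) (C i1 i1)
        (C i1 i2) (C i2 i2) => *.
  by rewrite /nf_scal; ring.
have dr (M : 'M[Z2]_3) w k : dot (row k M) w = (M *m w) k 0.
  by rewrite /dot !mxE; apply: eq_bigr => l _; rewrite !mxE.
have ord3 (Q : 'I_3 -> Prop) : Q i0 -> Q i1 -> Q i2 -> forall k, Q k.
  move=> q0 q1 q2 [[|[|[|//]]] lt]; [move: q0|move: q1|move: q2];
  by congr Q; apply: val_inj.
move=> w; rewrite /even_at !dotE !dr !parS => h1 h2 h3 h4 h5 h6.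
apply: P; apply/evmP; apply: ord3 => j; rewrite ord1 //.
by move: h1; rewrite h5 h6 !andbF !addbF.
Qed.

(** * Ranks 6 and 7 *)

(** If X w = 2u and u = X w0 + t with t in the complement, then X (w - 2 w0) = 2t lies in both
    summands, so it is 0; nondegeneracy of A gives w = 2 w0. *)
Lemma summand_primitive n k (G : 'M[Z2]_n) (A : 'M[Z2]_k) (X : 'M[Z2]_(n, k)) :
  is_lattice A -> is_primitive_representation G A X -> primitive X.
Proof.
move=> [_ An] [XE [T [[T0 [TD TZ]] [ST ST0]]]] w /evm_half [u uE].
have [s [t [[w0 sE] [Tt ust]]]] := ST u.
have Xt : X *m (w - 2 *: w0) = 2 *: t.
  by rewrite mulmxBr uE -scalemxAr -sE ust scalerDr addrAC subrr add0r.
have dt : 2 *: t = 0.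
  by apply: ST0; [exists (w - 2 *: w0) | apply: TZ].
have /An w0E : A *m (w - 2 *: w0) = 0 by rewrite -XE -mulmxA Xt dt mulmx0.
by rewrite -(subrK (2 *: w0) w) w0E add0r; apply: evm_dbl.
Qed.

Lemma test_form_lattice a c : a != 0 -> c != 0 -> is_lattice (test_form a c).
Proof.
move=> a0 c0; split.
  apply/matrixP => i j; rewrite !mxE.
  by case: i => -[|[|[|//]]] ?; case: j => -[|[|[|//]]] ?.
move=> v /matrixP h; have := (h i0 0, h i1 0, h i2 0).
rewrite ![(_ *m _) _ _]mxE !sum3 !test_formE ![(0 : 'M_(_, _)) _ _]mxE.
rewrite !mul0r !addr0 !add0r => -[[h0 h1] /eqP]; rewrite mulf_eq0 (negPf c0) /= => /eqP v2.
have three (x : Z2) : a * (3 * x) = 0 -> x = 0.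
  move=> /eqP; rewrite !mulf_eq0 (negPf a0) /= => /orP[/eqP h3|/eqP //].
  by have := par_nat 3; rewrite h3 par0.
have v0 : v i0 0 = 0.
  apply: three; have -> : a * (3 * v i0 0) = 2 * (2 * a * v i0 0 + a * v i1 0)
      - (a * v i0 0 + 2 * a * v i1 0) by ring.
  by rewrite h0 h1 mulr0 subr0.
have v1 : v i1 0 = 0.
  apply: three; have -> : a * (3 * v i1 0) = 2 * (a * v i0 0 + 2 * a * v i1 0)
      - (2 * a * v i0 0 + a * v i1 0) by ring.
  by rewrite h0 h1 mulr0 subr0.
apply/matrixP => i j; rewrite ord1 mxE; case: i => -[|[|[|//]]] lt;
[rewrite -v0|rewrite -v1|rewrite -v2]; congr (v _ _); exact: val_inj.
Qed.

Lemma rank6_not_universal (G : 'M[Z2]_6) : is_lattice G -> ~ prim_universal 3 G.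
Proof.
move=> Gl Gu; have [||D [C [Cs Dinj R]]] := @lattice_split G.
- exact: Gl.
- move=> a c a0 c0; have Al := test_form_lattice a0 c0.
  have [X XP] := Gu _ Al; exists X; first by case: XP.
  exact: summand_primitive Al XP.
have [U [V [d [uU uV E d_pow d_div]]]] := smith_normal_form D.
(* A zero diagonal entry would give a nonzero kernel vector of D^T. *)
have d0 i : d 0 i != 0.
  apply/eqP => di; pose v : 'cV[Z2]_3 := delta_mx i 0.
  have : V^T *m (D^T *m (U^T *m v)) = 0.
    rewrite !mulmxA -!trmx_mul mulmxA E tr_diag_mx /v -colE.
    apply/matrixP => j k; rewrite !mxE; case: eqP => [->|_]; rewrite ?mulr0n // di mulr1n //.
  rewrite -[0](mulmx0 _ V^T) => /(can_inj (@mulKmx _ _ _ V^T _)) /=.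
  rewrite unitmx_tr uV => /(_ isT) /Dinj; rewrite -[0](mulmx0 _ U^T).
  move=> /(can_inj (@mulKmx _ _ _ U^T _)); rewrite unitmx_tr uU => /(_ isT).
  by move/matrixP/(_ i 0); rewrite !mxE !eqxx => /eqP; rewrite oner_eq0.
have {}R a c : a != 0 -> c != 0 -> split_rep (diag_mx d) (V^T *m C *m V) (test_form a c).
  by move=> a0 c0; rewrite -E; apply: split_rep_basis (R a c a0 c0).
have C's : (V^T *m C *m V)^T = V^T *m C *m V by rewrite !trmx_mul trmxK Cs mulmxA.
have pow i : exists b, d 0 i = 2 ^+ b.
  by case: (d_pow i) => // di; have := d0 i; rewrite di eqxx.
have [[|b0] d0E] := pow i0.
  have [b d1E] := pow i1; have [q d2E] := d_div i1 i2 isT.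
  have q0 : q != 0 by have := d0 i2; rewrite d2E mulf_eq0 => /norP[].
  apply: (@nf_obstruction b q ((V^T *m C *m V) i0 i0) ((V^T *m C *m V) i1 i1)
           ((V^T *m C *m V) i1 i2) ((V^T *m C *m V) i2 i2) q0) => a c a0 c0.
  by rewrite -d1E -d2E; apply: diag_split_nf; [exact: C's | exact: d0E | exact: R].
have [d' dE] : exists d', diag_mx d = 2 *: diag_mx d'.
  have [d' d'E] : exists d', d = 2 *: d'.
    apply: evm_half; apply/evmP => i j; rewrite ord1.
    by have [q ->] := d_div i0 j isT; rewrite d0E exprS -mulrA par_dbl.
  by exists d'; rewrite d'E; apply: linearZ.
apply: (@split_even_obstruction (diag_mx d') (V^T *m C *m V)) => c c0.
by rewrite -dE; apply: R => //; apply: oner_neq0.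
Qed.

(** Take the orthogonal sum with m copies of <1>; the new coordinates join the complement of the
    image. *)
Lemma universal_extension k n m (G : 'M[Z2]_n) : is_lattice G -> prim_universal k G ->
  exists2 G' : 'M[Z2]_(n + m), is_lattice G' & prim_universal k G'.
Proof.
move=> [Gs Gn] Gu; exists (block_mx G 0 0 1%:M).
  split; first by rewrite tr_block_mx Gs !trmx0 trmx1.
  move=> v; rewrite -[v]vsubmxK mul_block_col !mul0mx mul1mx addr0 add0r.
  by rewrite -[0 in X in X -> _]col_mx0 => /eq_col_mx [/Gn -> ->]; rewrite col_mx0.
move=> A Al; have [X [XE [T [[T0 [TD TZ]] [ST ST0]]]]] := Gu A Al.
exists (col_mx X 0); split.
  rewrite /is_representation tr_col_mx trmx0 mul_row_block mul_row_col.
  by rewrite !(mulmx0, mul0mx, addr0).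
exists (fun v => T (usubmx v)); split; [split; [|split] | split].
- by rewrite linear0.
- by move=> u v Tu Tv; rewrite linearD; apply: TD.
- by move=> a v Tv; rewrite linearZ; apply: TZ.
- move=> v; have [s [t [[w sE] [Tt ust]]]] := ST (usubmx v).
  exists (col_mx s 0), (col_mx t (dsubmx v)); split; last split.
  + by exists w; rewrite mul_col_mx mul0mx sE.
  + by rewrite col_mxKu.
  by rewrite add_col_mx add0r -ust vsubmxK.
move=> v [w ->]; rewrite mul_col_mx mul0mx col_mxKu => TXw.
by rewrite (ST0 _ _ TXw) ?col_mx0 //; exists w.
Qed.

(** * The universal lattice H + H + H + <1> of rank 7 *)

Definition H3_1 : 'M[Z2]_(3 + 3 + 1) := block_mx (block_mx 0 1%:M 1%:M 0) 0 0 1%:M.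

Lemma H3_1_lattice : is_lattice H3_1.
Proof.
split; first by rewrite /H3_1 !tr_block_mx !trmx0 !trmx1.
have HH : H3_1 *m H3_1 = 1%:M.
  rewrite /H3_1 !mulmx_block !(mul0mx, mulmx0, mulmx1, addr0, add0r).
  by rewrite -!scalar_mx_block.
by move=> v Hv; rewrite -[v]mul1mx -HH -mulmxA Hv mulmx0.
Qed.

Lemma sym_decomposition n (A : 'M[Z2]_n) : A^T = A ->
  exists (Y : 'M[Z2]_n) (t : 'rV[Z2]_n), A = Y + Y^T + t^T *m t.
Proof.
move=> As; pose t : 'rV[Z2]_n := \row_i (par (A i i))%:R.
have h i : exists y, A i i = (par (A i i))%:R * (par (A i i))%:R + 2 * y.
  have [y {1}->] := par_exists (A i i); exists y; congr (_ + _).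
  by case: (par _); rewrite ?mulr1 ?mulr0.
pose Y : 'M[Z2]_n := \matrix_(i, j)
  if i == j then projT1 (cid (h i)) else if (i < j)%N then A i j - t 0 i * t 0 j else 0.
exists Y, t; apply/matrixP => i j; rewrite !mxE big_ord1 !mxE.
have sym : A j i = A i j by rewrite -{1}As mxE.
case: (eqVneq i j) => [->|ij].
  by case: (cid (h j)) => y /= yE; rewrite {1}yE; ring.
rewrite sym; case: (ltngtP i j) => [lt|lt|/val_inj e]; last by rewrite e eqxx in ij.
  by rewrite addr0 subrK.
by rewrite add0r [_ * (par (A i i))%:R]mulrC subrK.
Qed.

Lemma H3_1_universal : prim_universal 3 H3_1.
Proof.
move=> A [As _]; have [Y [t AE]] := sym_decomposition As.
pose X : 'M[Z2]_(3 + 3 + 1, 3) := col_mx (col_mx 1%:M Y) t; exists X; split.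
  rewrite /is_representation /X /H3_1 !tr_col_mx trmx1 -mulmxA !mul_block_col !mul_row_col.
  by rewrite !(mul0mx, mul1mx, mulmx1, addr0, add0r) mul_row_col mul1mx mulmx1 -AE.
(* The top block of X is the identity, so the vectors with zero top block form a complement. *)
exists (fun v => usubmx (usubmx v) = 0); split; [split; [|split] | split].
- by rewrite !linear0.
- by move=> u v Tu Tv; rewrite !linearD /= Tu Tv addr0.
- by move=> a v Tv; rewrite !linearZ /= Tv scaler0.
- move=> v; pose w := usubmx (usubmx v); exists (X *m w), (v - X *m w); split; first by exists w.
  split; last by rewrite addrC subrK.
  by rewrite !linearB /= !mul_col_mx !col_mxKu mul1mx subrr.
move=> v [w ->]; rewrite !mul_col_mx !col_mxKu mul1mx => ->.
by rewrite !mulmx0 !col_mx0.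
Qed.

Theorem theorem6p1 :
  (forall G : 'M[Z2]_6, is_lattice G -> ~ prim_universal 3 G) /\
  u_star_Z2_is 3 7.
Proof.
split; first exact: rank6_not_universal.
split; first by exists H3_1; split; [exact: H3_1_lattice | exact: H3_1_universal].
move=> r lt_r G Gl Gu.
have [] := universal_extension (6 - r) Gl Gu; rewrite subnKC // => G'.
exact: rank6_not_universal.
Qed.
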